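(* Let $u_h=\sum_{\boldsymbol{j}\in\mathcal{N}_h}u_{\boldsymbol{j}}\varphi_{\boldsymbol{j}}\in V_h$ be a solution of the stabilized nonlinear space--time problem: $u_h=\overline{u}_h$ on $\Gamma_D\times(0,T]$, $u_h(\cdot,0)=u_{0h}$ on $\Omega$, and $$(\partial_t u_h,v_h)+(\boldsymbol{\beta}\cdot\boldsymbol{\nabla}u_h,v_h)+\mu(\boldsymbol{\nabla}u_h,\boldsymbol{\nabla}v_h)+B_h(u_h;u_h,v_h)=(g,v_h)\qquad\forall v_h\in V_{h0},$$ where $B_h$ is the graph-Laplacian stabilization term built with the shock detector $\alpha_{\boldsymbol{i}}$ (all defined in the context). Suppose that $g=0$ and that, for every control point $\boldsymbol{i}\in\mathcal{N}_h$ such that $u_{\boldsymbol{i}}$ is a local discrete extremum (i.e. $u_h$ has a local discrete minimum or maximum on $\boldsymbol{i}$), it holds $$\tilde{\mathsf{K}}_{\boldsymbol{ij}}(u_h)\le 0\quad\forall\,\boldsymbol{j}\in\mathcal{S}_h^{\boldsymbol{i}}\setminus\{\boldsymbol{i}\},\qquad \sum_{\boldsymbol{j}\in\mathcal{S}_h^{\boldsymbol{i}}}\tilde{\mathsf{K}}_{\boldsymbol{ij}}(u_h)=0 .$$ Then $u_h$ satisfies the global space--time discrete maximum principle: for every $\boldsymbol{i}\in\mathcal{N}_h$, $$\min\Big(\min_{\boldsymbol{x}\in\Gamma_D,\,t\in[0,T)}\overline{u}_h(\boldsymbol{x},t),\ \min_{\boldsymbol{x}\in\Omega}u_{0h}(\boldsymbol{x})\Big)\le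 u_{\boldsymbol{i}}\le\max\Big(\max_{\boldsymbol{x}\in\Gamma_D,\,t\in[0,T)}\overline{u}_h(\boldsymbol{x},t),\ \max_{\boldsymbol{x}\in\Omega}u_{0h}(\boldsymbol{x})\Big).$$ Moreover, the scheme is linearity-preserving: $\mathsf{B}_{\boldsymbol{ij}}(u_h)=0$ whenever $u_h\in\mathcal{P}_1(\Omega_{\boldsymbol{i}})$, where $\Omega_{\boldsymbol{i}}$ is the convex hull of the set of Greville abscissae $\{\boldsymbol{x}_{\boldsymbol{j}}:\boldsymbol{j}\in\mathcal{N}_h^{\boldsymbol{k}},\ \boldsymbol{k}\in\mathcal{S}_h^{\boldsymbol{i}}\}$ and $\mathcal{P}_1$ denotes polynomials of total degree at most one in all space--time variables.
   Context: Continuous problem. $\Omega\times(0,T)=\prod_{\alpha=1}^{d+1}(0,L_\alpha)$ with $d$ spatial dimensions; the last coordinate is time. The problem is $\partial_t u+\boldsymbol{\nabla}\cdot(\boldsymbol{\beta}u)-\boldsymbol{\nabla}\cdot(\mu\boldsymbol{\nabla}u)=g$ in $\Omega\times(0,T]$, with $u=\overline{u}$ on the Dirichlet boundary and $u(\cdot,0)=u_0$. Here $\boldsymbol{\beta}$ is a divergence-free velocity, $\mu\ge0$ is a constant, and $\boldsymbol{\nabla}$ is the spatial gradient. The Dirichlet boundary is $\Gamma_D=\partial\Omega$ if $\mu>0$, and $\Gamma_D=\{\boldsymbol{x}\in\partial\Omega:\boldsymbol{\beta}\cdot\boldsymbol{n}<0\}$ (inflow, $\boldsymbol{n}$ the outward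 unit normal) if $\mu=0$. $(\cdot,\cdot)$ is the $L^2$ product over the space--time domain. Splines. Fix an order $p\ge1$. In each direction, $[0,L]$ is uniformly partitioned into $m$ intervals of size $L/m$, with open knot vector $\xi_1=\dots=\xi_{p+1}=0$, $\xi_i=(i-p-1)L/m$ for $i=p+1,\dots,m+p+1$, and $\xi_{m+p+1}=\dots=\xi_{m+2p+1}=L$. The B-splines $B_i^p$, $i=1,\dots,m+p$, are given by the Cox--de Boor recursion: $B_i^0=1$ on $[\xi_i,\xi_{i+1})$ and $0$ otherwise, $B_i^k(x)=\frac{x-\xi_i}{\xi_{i+k}-\xi_i}B_i^{k-1}(x)+\frac{\xi_{i+k+1}-x}{\xi_{i+k+1}-\xi_{i+1}}B_{i+1}^{k-1}(x)$. Greville abscissae: $x_i=(\xi_{i+1}+\dots+\xi_{i+p})/p$. With $m_\alpha$ intervals in direction $\alpha$, $\mathcal{N}_h$ is the set of multi-indices $\boldsymbol{i}=(i_1,\dots,i_{d+1})$ with $1\le i_\alpha\le m_\alpha+p$; $\varphi_{\boldsymbol{i}}=\prod_\alpha B^p_{i_\alpha}(x_\alpha)$; $\boldsymbol{x}_{\boldsymbol{i}}=(x_{i_1},\dots,x_{i_{d+1}})$; $V_h=\mathrm{span}\{\varphi_{\boldsymbol{i}}:\boldsymbol{i}\in\mathcal{N}_h\}$. Each $v_h\in V_h$ is written $v_h=\sum_{\boldsymbol{i}}v_{\boldsymbol{i}}\varphi_{\boldsymbol{i}}$, and the $v_{\boldsymbol{i}}$ are its control point values. $V_{h0}\subset V_h$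 is the subspace of functions vanishing on $\Gamma_D\times(0,T]$ and at $t=0$. $\overline{u}_h$, $u_{0h}$ are projections of $\overline{u}$, $u_0$ onto the spline space such that the local discrete maximum principle holds (each control value lies between the minimum and the maximum of the control values at its other neighbors). Index sets. $\mathcal{N}_h^{\boldsymbol{i}}=\{\boldsymbol{j}\in\mathcal{N}_h:|\boldsymbol{i}-\boldsymbol{j}|_\infty\le1\}$ and $\mathcal{S}_h^{\boldsymbol{i}}=\{\boldsymbol{j}\in\mathcal{N}_h:|\boldsymbol{i}-\boldsymbol{j}|_\infty\le p\}$. $u_h\in V_h$ has a local discrete minimum (resp. maximum) on $\boldsymbol{i}$ if $u_{\boldsymbol{i}}\le u_{\boldsymbol{j}}$ (resp. $u_{\boldsymbol{i}}\ge u_{\boldsymbol{j}}$) for all $\boldsymbol{j}\in\mathcal{N}_h^{\boldsymbol{i}}$. Matrices. $\mathsf{K}_{\boldsymbol{ij}}=(\partial_t\varphi_{\boldsymbol{j}},\varphi_{\boldsymbol{i}})+(\boldsymbol{\beta}\cdot\boldsymbol{\nabla}\varphi_{\boldsymbol{j}},\varphi_{\boldsymbol{i}})+\mu(\boldsymbol{\nabla}\varphi_{\boldsymbol{j}},\boldsymbol{\nabla}\varphi_{\boldsymbol{i}})$ (before applying boundary conditions), $\mathsf{B}_{\boldsymbol{ij}}(u_h)=B_h(u_h;\varphi_{\boldsymbol{j}},\varphi_{\boldsymbol{i}})$, $\tilde{\mathsf{K}}_{\boldsymbol{ij}}(u_h)=\mathsf{K}_{\boldsymbol{ij}}+\mathsf{B}_{\boldsymbol{ij}}(u_h)$.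 Stabilization. $B_h(w_h;u_h,v_h)=\sum_{\boldsymbol{i}\in\mathcal{N}_h}\sum_{\boldsymbol{j}\in\mathcal{S}_h^{\boldsymbol{i}}}\nu_{\boldsymbol{ij}}(w_h)\,v_{\boldsymbol{i}}u_{\boldsymbol{j}}\,\ell(\boldsymbol{i},\boldsymbol{j})$ with $\ell(\boldsymbol{i},\boldsymbol{j})=2\delta_{\boldsymbol{ij}}-1$; $\nu_{\boldsymbol{ij}}(w_h)=\max\{\alpha_{\boldsymbol{i}}(w_h)\mathsf{K}_{\boldsymbol{ij}},0,\alpha_{\boldsymbol{j}}(w_h)\mathsf{K}_{\boldsymbol{ji}}\}$ for $\boldsymbol{j}\in\mathcal{S}_h^{\boldsymbol{i}}\setminus\{\boldsymbol{i}\}$; $\nu_{\boldsymbol{ii}}(w_h)=\sum_{\boldsymbol{j}\in\mathcal{S}_h^{\boldsymbol{i}}\setminus\{\boldsymbol{i}\}}\nu_{\boldsymbol{ij}}(w_h)$. Shock detector. For $\boldsymbol{j}\in\mathcal{N}_h^{\boldsymbol{i}}\setminus\{\boldsymbol{i}\}$ let $\boldsymbol{r}_{\boldsymbol{ij}}=\boldsymbol{x}_{\boldsymbol{j}}-\boldsymbol{x}_{\boldsymbol{i}}$ and $\hat{\boldsymbol{r}}_{\boldsymbol{ij}}=\boldsymbol{r}_{\boldsymbol{ij}}/|\boldsymbol{r}_{\boldsymbol{ij}}|$. Let $\mathcal{Q}_{\boldsymbol{i}}$ be the $(d+1)$-dimensional polytope with vertices $\{\boldsymbol{x}_{\boldsymbol{j}}:\boldsymbol{j}\in\mathcal{N}_h^{\boldsymbol{i}}\setminus\{\boldsymbol{i}\}\}$.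 $\boldsymbol{x}_{\boldsymbol{ij}}^{\rm sym}$ is the intersection point, other than $\boldsymbol{x}_{\boldsymbol{j}}$, of $\partial\mathcal{Q}_{\boldsymbol{i}}$ with the line through $\boldsymbol{x}_{\boldsymbol{i}}$ and $\boldsymbol{x}_{\boldsymbol{j}}$, and $\boldsymbol{r}_{\boldsymbol{ij}}^{\rm sym}=\boldsymbol{x}_{\boldsymbol{ij}}^{\rm sym}-\boldsymbol{x}_{\boldsymbol{i}}$. $u_{\boldsymbol{j}}^{\rm sym}$ is the linear interpolation at $\boldsymbol{x}_{\boldsymbol{ij}}^{\rm sym}$ of the control point values whose Greville abscissae are on the facet of $\partial\mathcal{Q}_{\boldsymbol{i}}$ containing $\boldsymbol{x}_{\boldsymbol{ij}}^{\rm sym}$ (in two dimensions, linear interpolation between the two end points of the edge containing it). Set $$J_{\boldsymbol{ij}}=\frac{u_{\boldsymbol{j}}-u_{\boldsymbol{i}}}{|\boldsymbol{r}_{\boldsymbol{ij}}|}+\frac{u_{\boldsymbol{j}}^{\rm sym}-u_{\boldsymbol{i}}}{|\boldsymbol{r}_{\boldsymbol{ij}}^{\rm sym}|},\qquad M_{\boldsymbol{ij}}=\frac12\left(\frac{|u_{\boldsymbol{j}}-u_{\boldsymbol{i}}|}{|\boldsymbol{r}_{\boldsymbol{ij}}|}+\frac{|u_{\boldsymbol{j}}^{\rm sym}-u_{\boldsymbol{i}}|}{|\boldsymbol{r}_{\boldsymbol{ij}}^{\rm sym}|}\right).$$ With sums over $\boldsymbol{j}\in\mathcal{N}_h^{\boldsymbol{i}}\setminus\{\boldsymbol{i}\}$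 and an exponent $q>0$, $\alpha_{\boldsymbol{i}}(u_h)=\left[\frac{|\sum_{\boldsymbol{j}}J_{\boldsymbol{ij}}|}{\sum_{\boldsymbol{j}}2M_{\boldsymbol{ij}}}\right]^q$ if $\sum_{\boldsymbol{j}}M_{\boldsymbol{ij}}\ne0$, and $\alpha_{\boldsymbol{i}}(u_h)=0$ otherwise.
   Formalization: Data control values are assumed within the stated bounds (the local DMP alone does not ensure this); at boundary control points, where x^sym is undefined, linearity preservation assumes x^sym lies beyond x_i with affine-exact weights. The velocity is taken time-independent and C^1. *)

(* Defs.v *)
From HB Require Import structures.
From mathcomp Require Import all_boot all_order all_algebra.
From mathcomp Require Import all_classical all_reals all_analysis.
Set Implicit Arguments. Unset Strict Implicit. Unset Printing Implicit Defensive.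
Import Order.TTheory GRing.Theory Num.Theory numFieldNormedType.Exports.
Local Open Scope classical_set_scope.
Local Open Scope ring_scope.

Section tuple_measure.
Local Open Scope ereal_scope.
Context {d} {T : measurableType d} {R : realType}.

Definition tcons n (x : T * n.-tuple T) : n.+1.-tuple T :=
  [the n.+1.-tuple T of x.1 :: x.2].

Definition tuncons n (t : n.+1.-tuple T) : T * n.-tuple T :=
  (thead t, [tuple of behead t]).

Lemma tconsK n : cancel (@tcons n) (@tuncons n).
Proof. by move=> [x t]; rewrite /tuncons /tcons theadE; congr pair; apply/val_inj. Qed.

Lemma tunconsK n : cancel (@tuncons n) (@tcons n).
Proof. by move=> t; rewrite /tcons /tuncons /= [RHS]tuple_eta. Qed.

Lemma measurable_tcons n : measurable_fun setT (@tcons n).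
Proof. exact: (measurable_cons measurable_fst measurable_snd). Qed.

Lemma measurable_tuncons n : measurable_fun setT (@tuncons n).
Proof.
apply: measurable_fun_pair; [exact: measurable_tnth|exact: measurable_behead].
Qed.

Variables (m1 : {sigma_finite_measure set T -> \bar R}).

Section step.
Variables (n : nat) (mu : {sigma_finite_measure set (n.-tuple T) -> \bar R}).

Definition tcons_measure : set (n.+1.-tuple T) -> \bar R :=
  pushforward (m1 \x mu) (@tcons n).

HB.instance Definition _ := Measure.copy tcons_measure
  (measure_function_pushforward__canonical__measure_function_Measure (m1 \x mu) (@measurable_tcons n)).

Lemma tcons_measure_sigma_finite : sigma_finite setT tcons_measure.
Proof.
have /sigma_finiteP[F [TF ndF Foo]] := sigma_finiteT m1.
have /sigma_finiteP[G [TG ndG Goo]] := sigma_finiteT mu.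
exists (fun k => @tuncons n @^-1` (F k `*` G k)).
  rewrite -preimage_bigcup; apply/esym; rewrite -subTset => t _ /=.
  case: (tuncons t) => x y.
  have [i _ Fx] : (\bigcup_k F k) x by rewrite -TF.
  have [j _ Gy] : (\bigcup_k G k) y by rewrite -TG.
  exists (maxn i j) => //; split.
    by move: x Fx; exact/subsetPset/ndF/leq_maxl.
  by move: y Gy; exact/subsetPset/ndG/leq_maxr.
move=> k; have [mF Fk] := Foo k; have [mG Gk] := Goo k; split.
  rewrite -[X in measurable X]setTI; apply: measurable_tuncons => //.
  exact: measurableX.
rewrite /tcons_measure /pushforward -comp_preimage.
rewrite (_ : _ \o _ = id) ?preimage_id; last first.
  by apply/funext => x; exact: tconsK.
by rewrite product_measure1E// lte_mul_pinfty// ge0_fin_numE.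
Qed.

HB.instance Definition _ := Measure_isSigmaFinite.Build _ _ _ tcons_measure
  tcons_measure_sigma_finite.
End step.

(* n-fold product of m1, carried by the product sigma-algebra on n-tuples *)
Fixpoint tuple_measure n : {sigma_finite_measure set (n.-tuple T) -> \bar R} :=
  if n is k.+1 then tcons_measure (tuple_measure k)
  else (\d_ [tuple]).

End tuple_measure.

Arguments tuple_measure {d T R} m1 n.

Definition lebesgue_tuple (R : realType) (n : nat) :=
  tuple_measure (@lebesgue_measure R) n.

Section points.
Variables (R : realType) (n : nat).
Implicit Types (x y : 'rV[R]_n) (f g : 'rV[R]_n -> R) (S : set 'rV[R]_n).

Definition open_box (L : 'I_n -> R) : set 'rV[R]_n :=
  [set x | forall a, 0 < x 0 a < L a].

Definition closed_box (L : 'I_n -> R) : set 'rV[R]_n :=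
  [set x | forall a, 0 <= x 0 a <= L a].

(* The integrand takes row vectors, the measure lives on tuples. Derivatives of
   splines of order 1 do not exist on the knot hyperplanes, a null set. *)
Definition box_integral (L : 'I_n -> R) f : R :=
  \int[lebesgue_tuple R n]_(t in [set t | open_box L (\row_a tnth t a)])
    f (\row_a tnth t a).

Definition pderiv (a : 'I_n) f : 'rV[R]_n -> R := 'D_(delta_mx 0 a) f.

Definition dot x y : R := \sum_a x 0 a * y 0 a.

(* the norm of the library on 'rV[R]_n is the sup norm *)
Definition enorm x : R := Num.sqrt (dot x x).

Definition conv_hull S : set 'rV[R]_n := smallest (@convex_set R 'rV[R]_n) S.

Definition bdry S : set 'rV[R]_n := closure S `\` S°.

Definition affine_on S f :=
  exists (c : R) (b : 'rV[R]_n), forall x, S x -> f x = c + dot b x.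

End points.

(* Indices start at 0: knot L m p k is the knot number k + 1 of the usual
   1-based numbering. *)
Section bsplines_1d.
Variables (R : realType) (L : R) (m p : nat).

(* truncated subtraction gives the p + 1 knots at 0, minn those at L *)
Definition knot (k : nat) : R := L * (minn (k - p) m)%:R / m%:R.

(* B-spline of degree k and index i for the fixed knot vector of order p.
   The last nonempty knot interval is closed at L, so that splines are
   continuous on [0, L]; with the half-open convention alone they would all
   vanish at L. Zero denominators only occur together with a zero factor. *)
Fixpoint bspline (k i : nat) (x : R) : R :=
  if k is k'.+1 then
    (x - knot i) / (knot (i + k) - knot i) * bspline k' i x
    + (knot (i + k).+1 - x) / (knot (i + k).+1 - knot i.+1) * bspline k' i.+1 x
  else ((knot i <= x < knot i.+1) || ((i.+1 == m + p)%N && (x == L)))%:R.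

Definition greville (i : nat) : R := (\sum_(1 <= k < p.+1) knot (i + k)) / p%:R.

End bsplines_1d.

Definition cidx (n : nat) (m : 'I_n -> nat) (p : nat) :=
  {dffun forall a : 'I_n, 'I_(m a + p)}.

(* control point values, standing for the spline they define *)
Definition cval (R : realType) (n : nat) (m : 'I_n -> nat) (p : nat) :=
  {ffun cidx m p -> R}.

Section splines.
Variables (R : realType) (n : nat) (m : 'I_n -> nat) (p : nat) (L : 'I_n -> R).
Implicit Types (i j : cidx m p) (u : cval R m p) (x : 'rV[R]_n).

Definition tbasis i x : R := \prod_a bspline (L a) (m a) p p (i a) (x 0 a).

Definition spline u x : R := \sum_i u i * tbasis i x.

Definition unit_cval i : cval R m p := [ffun j => (j == i)%:R].

Definition gpoint i : 'rV[R]_n := \row_a greville (L a) (m a) p (i a).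

Definition within (r : nat) i j :=
  [forall a, (i a <= j a + r)%N && (j a <= i a + r)%N].

Definition Nh i : {set cidx m p} := [set j | within 1 i j].
Definition Sh i : {set cidx m p} := [set j | within p i j].

Definition local_min u i := forall j, j \in Nh i -> u i <= u j.
Definition local_max u i := forall j, j \in Nh i -> u j <= u i.

End splines.

Section detector.
Variables (R : realType) (d : nat).
Notation D := d.+1.
Variables (m : 'I_D -> nat) (p : nat) (L : 'I_D -> R).
Implicit Types (i j k l : cidx m p) (u : cval R m p) (y : 'rV[R]_D).
Notation xg := (gpoint L).

Definition Qset i : set 'rV[R]_D :=
  conv_hull [set xg j | j in [set j | j \in Nh i :\ i]].

Definition on_line i j y s := y = xg i + s *: (xg j - xg i).

Definition is_xsym i j y :=
  [/\ bdry (Qset i) y, y != xg j & exists s, on_line i j y s].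

(* The hyperplane dot c = b supports Q_i and cuts out a facet containing y:
   the vertices on it span, from y, a space of dimension d = (d + 1) - 1. *)
Definition is_facet i (c : 'rV[R]_D) (b : R) y :=
  [/\ c != 0, forall k, k \in Nh i :\ i -> dot c (xg k) <= b, dot c y = b &
      \rank (\sum_(k in Nh i :\ i | dot c (xg k) == b) <<xg k - y>>)%MS = d].

(* Weights of a linear interpolation at y from the control points on a facet
   containing y. On an edge (d + 1 = 2) the two end points are one choice;
   facets of dimension >= 2, or edges with an intermediate Greville point, allow
   several choices. *)
Definition is_facet_interp i y (w : cidx m p -> R) :=
  (exists c b, is_facet i c b y /\
     forall k, w k != 0 -> k \in Nh i :\ i /\ dot c (xg k) = b)
  /\ [/\ forall k, 0 <= w k, \sum_k w k = 1 & \sum_k w k *: xg k = y].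

Record sym_data := SymData {
  xsym : cidx m p -> cidx m p -> 'rV[R]_D;
  wsym : cidx m p -> cidx m p -> cidx m p -> R }.

(* A control point with x_i interior to Q_i: exactly there every line through
   x_i and x_j meets the boundary of Q_i in one further point, on the other side
   of x_i. *)
Definition interior_cp i := (Qset i)° (xg i).

Definition is_sym_data (sd : sym_data) :=
  forall i j, interior_cp i -> j \in Nh i :\ i ->
    is_xsym i j (xsym sd i j) /\ is_facet_interp i (xsym sd i j) (wsym sd i j).

(* Symmetric data at i lying strictly beyond x_i and reproducing affine
   functions, possibly by extrapolation. *)
Definition exact_sym_data (sd : sym_data) i :=
  forall j, j \in Nh i :\ i ->
    [/\ exists2 s, s < 0 & on_line i j (xsym sd i j) s,
        \sum_(k in Nh i) wsym sd i j k = 1 &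
        \sum_(k in Nh i) wsym sd i j k *: xg k = xsym sd i j].

Variable sd : sym_data.

Definition usym u i j : R := \sum_(k in Nh i) wsym sd i j k * u k.

Definition rnorm i j : R := enorm (xg j - xg i).
Definition rnorm_sym i j : R := enorm (xsym sd i j - xg i).

Definition Jump u i j : R :=
  (u j - u i) / rnorm i j + (usym u i j - u i) / rnorm_sym i j.

Definition Mean u i j : R :=
  2^-1 * (`|u j - u i| / rnorm i j + `|usym u i j - u i| / rnorm_sym i j).

Variable q : R.

Definition alpha u i : R :=
  if \sum_(j in Nh i :\ i) Mean u i j != 0 then
    (`|\sum_(j in Nh i :\ i) Jump u i j|
       / \sum_(j in Nh i :\ i) (2 * Mean u i j)) `^ q
  else 0.

Definition Omega_i i : set 'rV[R]_D :=
  conv_hull [set xg j | j in [set j | exists2 k, k \in Sh i & j \in Nh k]].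

End detector.

Section problem.
Variables (R : realType) (d : nat).
Notation D := d.+1.
Variables (m : 'I_D -> nat) (p : nat) (L : 'I_D -> R) (mu : R).
Variable beta : 'rV[R]_d -> 'rV[R]_d.
Implicit Types (i j : cidx m p) (u v w : cval R m p) (f g : 'rV[R]_D -> R).

Definition space_dir (k : 'I_d) : 'I_D := lift ord_max k.
Definition L_space (k : 'I_d) : R := L (space_dir k).
Definition m_space (k : 'I_d) : nat := m (space_dir k).
Definition T_end : R := L ord_max.

Definition space_part (z : 'rV[R]_D) : 'rV[R]_d := \row_k z 0 (space_dir k).
Definition st_point (x : 'rV[R]_d) (t : R) : 'rV[R]_D :=
  \row_a (if unlift ord_max a is Some k then x 0 k else t).

Definition velocity_C1 :=
  (forall x, closed_box L_space x -> differentiable beta x) /\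
  (forall k l : 'I_d, {within closed_box L_space,
     continuous (fun x => ('D_(delta_mx 0 l) beta x) 0 k)}).

Definition divergence_free :=
  forall x, open_box L_space x ->
    \sum_(k < d) ('D_(delta_mx 0 k) beta x) 0 k = 0.

(* At edges and corners the condition on the inflow boundary is required for one
   of the faces containing the point. *)
Definition Gamma_D : set 'rV[R]_d :=
  [set x | closed_box L_space x /\ exists k : 'I_d,
     (x 0 k = 0 /\ (0 < mu \/ - beta x 0 k < 0)) \/
     (x 0 k = L_space k /\ (0 < mu \/ beta x 0 k < 0))].

Definition inner f g : R := box_integral L (fun z => f z * g z).

Definition dt f := pderiv ord_max f.
Definition advection f : 'rV[R]_D -> R :=
  fun z => \sum_(k < d) beta (space_part z) 0 k * pderiv (space_dir k) f z.

Definition galerkin f g : R :=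
  inner (dt f) g + inner (advection f) g
  + mu * \sum_(k < d) inner (pderiv (space_dir k) f) (pderiv (space_dir k) g).

Definition Kmat i j : R := galerkin (tbasis L j) (tbasis L i).

Variables (q : R) (sd : sym_data R m p).

Definition nu_off w i j : R :=
  Num.max (Num.max (alpha L sd q w i * Kmat i j) 0) (alpha L sd q w j * Kmat j i).

Definition nu w i j : R :=
  if j == i then \sum_(k in Sh i :\ i) nu_off w i k else nu_off w i j.

Definition ell i j : R := 2 * (i == j)%:R - 1.

Definition Bh w u v : R :=
  \sum_i \sum_(j in Sh i) nu w i j * v i * u j * ell i j.

Definition Bmat w i j : R := Bh w (unit_cval R j) (unit_cval R i).

Definition Ktilde w i j : R := Kmat i j + Bmat w i j.

Definition Vh0 v :=
  (forall x t, Gamma_D x -> 0 < t <= T_end -> spline L v (st_point x t) = 0) /\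
  (forall x, open_box L_space x -> spline L v (st_point x 0) = 0).

Variables (g : 'rV[R]_D -> R) (ubar : cval R m p) (u0 : cval R m_space p).

Definition is_solution u :=
  [/\ forall x t, Gamma_D x -> 0 < t <= T_end ->
        spline L u (st_point x t) = spline L ubar (st_point x t),
      forall x, open_box L_space x ->
        spline L u (st_point x 0) = spline L_space u0 x &
      forall v, Vh0 v ->
        galerkin (spline L u) (spline L v) + Bh u u v = inner g (spline L v)].

(* Extended-real bounds, so that an empty Gamma_D is simply ignored. *)
Definition ubar_values : set (\bar R) :=
  [set y | exists x t, [/\ Gamma_D x, 0 <= t < T_end &
                          y = (spline L ubar (st_point x t))%:E]].
Definition u0_values : set (\bar R) :=
  [set (spline L_space u0 x)%:E | x in open_box L_space].

Definition data_min : \bar R :=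
  Order.min (ereal_inf ubar_values) (ereal_inf u0_values).
Definition data_max : \bar R :=
  Order.max (ereal_sup ubar_values) (ereal_sup u0_values).

Definition in_data_range (c : R) := (data_min <= c%:E <= data_max)%E.

(* The projected data create no overshoot: their control values that are
   determined by the boundary and initial conditions stay in the range of the
   data. *)
Definition data_dmp :=
  (forall j, (exists x t, [/\ Gamma_D x, 0 < t <= T_end &
                              tbasis L j (st_point x t) != 0]) ->
     in_data_range (ubar j)) /\
  (forall i : cidx m_space p, in_data_range (u0 i)).

End problem.

(* Main.v *)
Require Import Defs.
From mathcomp Require Import all_boot all_order all_algebra.
From mathcomp Require Import all_classical all_reals all_analysis.
From mathcomp Require Import measurable_realfun.
From mathcomp Require Import ring lra zify.
Set Implicit Arguments. Unset Strict Implicit. Unset Printing Implicit Defensive.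
Import Order.TTheory GRing.Theory Num.Theory numFieldNormedType.Exports.
Local Open Scope classical_set_scope.
Local Open Scope ring_scope.

(** Maximum principle. Let u_i be a global maximum of the control values. If i
    is not constrained by the data, its basis function is an admissible test
    function, so row i of the stabilized matrix annihilates u; as the row sums to
    0 and is nonpositive off the diagonal, u_j = u_i whenever the entry (i,j) is
    negative. That alone could leave the maximum on a set of indices not
    connected to the data. The way out is backwards in time: the basis functions
    with time index smaller than that of i add up, over all spatial indices, to a
    function of t alone, which decreases on the support of the i-th basis
    function. Its advection and diffusion terms vanish, so these entries of row i
    of the Galerkin matrix have a negative sum and one of them is negative
    (Kmat_upwind); the stabilization only lowers it (Ktilde_le). Hence the maximum
    is also attained at an index that is strictly earlier, and the descent ends
    at a constrained index (extremum_in_range). Minima are treated in the same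
    way.

    At a constrained index the control value of u has to be compared with that of
    the data, although only the values of the splines on Gamma_D and at t = 0 are
    prescribed, and Gamma_D may be a small piece of a face. This is local linear
    independence: B-splines that do not vanish on a knot interval are linearly
    independent on each of its open subintervals (bpoly_free, separates_itv),
    which passes to tensor products direction by direction (tensor_coef_eq0).

    All facts on B-splines are proved for the polynomials that represent them on
    one knot interval. The integrals only see these polynomials, because the knot
    hyperplanes are a null set; there the derivatives may fail to exist.

    Linearity preservation. An affine function c + b.x has the coefficients
    c + b.x_j, so by local linear independence these are the control values of u
    at all the indices that enter the detectors of the stencil of i
    (affine_coef). At each of these, x_j and its symmetric point lie on opposite
    sides, hence the difference quotients of an affine function cancel, the
    detector vanishes and with it the stabilization. That the symmetric point of
    an interior control point lies beyond this point is a fact on convex hulls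
    (xsym_beyond). *)

(** * B-splines on one knot interval *)

Section bpoly.
Variables (R : realFieldType) (xi : nat -> R) (l : nat).
Implicit Types (i k N : nat) (c : nat -> R).

(** The Cox--de Boor recursion run inside {poly R}, started from the
    polynomials that the splines of degree 0 are on the interval number l. *)
Fixpoint bpoly k i : {poly R} :=
  if k is k'.+1 then
    (xi (i + k) - xi i)^-1 *: (('X - (xi i)%:P) * bpoly k' i)
    + (xi (i + k).+1 - xi i.+1)^-1 *: (((xi (i + k).+1)%:P - 'X) * bpoly k' i.+1)
  else (i == l)%:R%:P.

Lemma bpoly_out k i : ~~ (i <= l <= i + k)%N -> bpoly k i = 0.
Proof.
elim: k i => [|k IH] i /= out.
  by rewrite (_ : (i == l) = false) ?polyC0//; lia.
rewrite !IH ?mulr0 ?scaler0 ?addr0//; lia.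
Qed.

Hypothesis xi_mono : {homo xi : a b / (a <= b)%N >-> a <= b}.
Hypothesis cell : xi l < xi l.+1.

Lemma knot_span_gt0 i j : (i <= l < j)%N -> 0 < xi j - xi i.
Proof.
move=> /andP[il lj]; rewrite subr_gt0.
by rewrite (le_lt_trans (xi_mono il))// (lt_le_trans cell)// xi_mono.
Qed.

Lemma bpoly_gt0 k i x : (i <= l <= i + k)%N -> xi l < x < xi l.+1 ->
  0 < (bpoly k i).[x].
Proof.
move=> + /andP[lx xl]; elim: k i => [|k IH] i /= il.
  by rewrite (_ : i == l) ?hornerC ?ltr01//; lia.
rewrite !hornerE /= -!mulrA.
have t1 j : (i <= l <= i + k)%N -> j = (i + k.+1)%N ->
    0 < (xi j - xi i)^-1 * ((x - xi i) * (bpoly k i).[x]).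
  move=> h ->; rewrite mulr_gt0 ?invr_gt0 ?knot_span_gt0//; first lia.
  rewrite mulr_gt0 ?IH// subr_gt0 (le_lt_trans _ lx)//; apply: xi_mono; lia.
have t2 : (i.+1 <= l <= i.+1 + k)%N ->
    0 < (xi (i + k.+1).+1 - xi i.+1)^-1 *
        ((xi (i + k.+1).+1 - x) * (bpoly k i.+1).[x]).
  move=> h; rewrite mulr_gt0 ?invr_gt0 ?knot_span_gt0//; first lia.
  rewrite mulr_gt0 ?IH// subr_gt0 (lt_le_trans xl)//; apply: xi_mono; lia.
case h1 : (i <= l <= i + k)%N; case h2 : (i.+1 <= l <= i.+1 + k)%N.
- by apply: addr_gt0; [exact: t1|exact: t2].
- by rewrite (@bpoly_out k i.+1) ?h2// horner0 !mulr0 addr0; exact: t1.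
- by rewrite (@bpoly_out k i) ?h1// horner0 !mulr0 add0r; exact: t2.
- lia.
Qed.

(** Differentiating the recursion and comparing with the recursion itself
    leaves only a multiple of the B-spline of degree k - 1 and index i + 1,
    whose coefficient is the difference of the two normalized knot spans. These
    are both 1, unless a span is 0 and then this B-spline vanishes. *)
Lemma deriv_bpoly k i :
  (bpoly k.+1 i)^`() =
    (k.+1%:R / (xi (i + k.+1) - xi i)) *: bpoly k i
    - (k.+1%:R / (xi (i + k.+1).+1 - xi i.+1)) *: bpoly k i.+1.
Proof.
elim: k i => [|k IH] i.
  rewrite /= !derivD !derivZ !derivM !derivB !derivX !derivC !mulr0 !addr0 !mul1r.
  by rewrite subr0 sub0r mul1r mulN1r scalerN.
rewrite [bpoly k.+2 i]/=.
rewrite derivD !derivZ !derivM !derivB !derivX !derivC subr0 sub0r !IH.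
have E1 : bpoly k.+1 i = (xi (i + k.+1) - xi i)^-1 *: (('X - (xi i)%:P) * bpoly k i)
    + (xi (i + k.+1).+1 - xi i.+1)^-1 *: (((xi (i + k.+1).+1)%:P - 'X) * bpoly k i.+1).
  by [].
have E2 : bpoly k.+1 i.+1 = (xi (i.+1 + k.+1) - xi i.+1)^-1 *: (('X - (xi i.+1)%:P) * bpoly k i.+1)
    + (xi (i.+1 + k.+1).+1 - xi i.+2)^-1 *: (((xi (i.+1 + k.+1).+1)%:P - 'X) * bpoly k i.+2).
  by [].
have span : (xi (i + k.+2) - xi i)^-1 * (xi (i + k.+2) - xi i) *: bpoly k i.+1
   = (xi (i + k.+2).+1 - xi i.+1)^-1 * (xi (i + k.+2).+1 - xi i.+1) *: bpoly k i.+1.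
  case h : (i.+1 <= l <= i.+1 + k)%N; last first.
    by rewrite bpoly_out ?scaler0 ?h.
  by rewrite !mulVf// gt_eqF// knot_span_gt0//; lia.
move: span; rewrite E1 E2 !addSn !addnS.
move: (bpoly k i) (bpoly k i.+1) (bpoly k i.+2) => b0 b1 b2.
move: (_ - xi i)^-1 (_ - xi i.+1)^-1 => a0 a1.
move: (_ - xi i)^-1 (_ - xi i.+1)^-1 (_ - xi i.+2)^-1 => e0 e1 e2 span.
rewrite -!mul_polyC in span *.
set P := LHS; set Q := RHS; suff -> : P = Q + (k.+1%:R * e1)%:P *
    ((a1 * (xi (i + k).+3 - xi i.+1))%:P * b1 - (a0 * (xi (i + k).+2 - xi i))%:P * b1).
  by rewrite span subrr mulr0 addr0.
rewrite /P /Q {span P Q IH E1 E2}; ring.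
Qed.

Lemma shift_sum (V : lmodType R) N c (F : nat -> V) : F 0%N = 0 -> F N = 0 ->
  \sum_(i < N) c i *: F i.+1 = \sum_(i < N) c i.-1 *: F i.
Proof.
case: N => [|N] F0 FN; first by rewrite !big_ord0.
by rewrite big_ord_recr big_ord_recl /= F0 FN !scaler0 addr0 add0r.
Qed.

Lemma deriv_sum_bpoly k N c : (k < l < N)%N ->
  (\sum_(i < N) c i *: bpoly k.+1 i)^`() =
  \sum_(i < N) (k.+1%:R * (c i - c i.-1) / (xi (i + k.+1) - xi i)) *: bpoly k i.
Proof.
move=> /andP[kl lN]; rewrite raddf_sum /=.
under eq_bigr do rewrite derivZ deriv_bpoly scalerBr -addSn.
rewrite sumrB.
rewrite (shift_sum c (F := fun i => (k.+1%:R / (xi (i + k.+1) - xi i)) *: bpoly k i)).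
- rewrite -sumrB; apply: eq_bigr => i _.
  by rewrite -scalerBl scalerA; congr (_ *: _); ring.
- by rewrite bpoly_out ?scaler0//; lia.
- by rewrite bpoly_out ?scaler0//; lia.
Qed.

Lemma sum_bpolyS k N c : (k < l < N)%N ->
  \sum_(i < N) c i *: bpoly k.+1 i =
  \sum_(i < N) (xi (i + k.+1) - xi i)^-1 *:
     ((c i *: ('X - (xi i)%:P) + c i.-1 *: ((xi (i + k.+1))%:P - 'X)) * bpoly k i).
Proof.
move=> /andP[kl lN] /=.
under eq_bigr do rewrite scalerDr -addSn.
rewrite big_split /=.
rewrite (shift_sum c (F := fun i => (xi (i + k.+1) - xi i)^-1 *:
     (((xi (i + k.+1))%:P - 'X) * bpoly k i))).
- rewrite -big_split; apply: eq_bigr => i _ /=.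
  by rewrite -!mul_polyC; ring.
- by rewrite bpoly_out ?mulr0 ?scaler0//; lia.
- by rewrite bpoly_out ?mulr0 ?scaler0//; lia.
Qed.

(** A knot span of length 0 has the inverse 0, but then the B-spline vanishes. *)
Lemma bpoly_span k i :
  (xi (i + k.+1) - xi i)^-1 *: ((xi (i + k.+1) - xi i) *: bpoly k i) = bpoly k i.
Proof.
case h : (i <= l <= i + k)%N; last by rewrite bpoly_out ?h// !scaler0.
by rewrite scalerA mulVf ?scale1r// gt_eqF// knot_span_gt0//; lia.
Qed.

Lemma sum_bpoly1 k N : (k <= l < N)%N -> \sum_(i < N) bpoly k i = 1.
Proof.
elim: k => [|k IH] h.
  have lN : (l < N)%N by lia.
  rewrite (bigD1 (Ordinal lN))//= eqxx big1 ?addr0// => i il.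
  by rewrite (_ : (i == l :> nat) = false) ?polyC0//; apply/negbTE.
under eq_bigr do rewrite -[bpoly _ _]scale1r.
rewrite (sum_bpolyS (fun=> 1)); last lia.
rewrite -IH; last lia.
apply: eq_bigr => i _; rewrite -[RHS]bpoly_span.
by congr (_ *: _); rewrite -!mul_polyC; ring.
Qed.

(** Marsden's identity for the identity function. *)
Lemma sum_bpoly_greville k N : (k <= l < N)%N ->
  \sum_(i < N) (\sum_(1 <= r < k.+1) xi (i + r)) *: bpoly k i = k%:R *: 'X.
Proof.
elim: k => [|k IH] h.
  by rewrite scale0r big1// => i _; rewrite big_geq// scale0r.
rewrite (sum_bpolyS (fun i => \sum_(1 <= r < k.+2) xi (i + r)%N)); last lia.
transitivity (\sum_(i < N) ((\sum_(1 <= r < k.+1) xi (i + r)) *: bpoly k i + 'X * bpoly k i)).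
  apply: eq_bigr => -[i /= _] _; case h' : (i <= l <= i + k)%N; last first.
    by rewrite bpoly_out ?h'// !mulr0 !scaler0 addr0.
  case: i h' => [|i] h'; first lia.
  rewrite (_ : _ *: bpoly k i.+1 + _ =
      ((\sum_(1 <= r < k.+1) xi (i.+1 + r))%:P + 'X) * bpoly k i.+1); last first.
    by rewrite -mul_polyC mulrDl.
  rewrite -[in RHS]bpoly_span -!mul_polyC /=.
  rewrite big_nat_recr //= [X in X%:P * (_ - 'X)]big_ltn//= addn1.
  rewrite [X in (_ + X)%:P * (_ - 'X)]big_add1 /=.
  under [X in (_ + X)%:P * (_ - 'X)]eq_bigr do rewrite addnS -addSn.
  ring.
rewrite big_split /= IH; last lia.
rewrite -mulr_sumr sum_bpoly1; last lia.
by rewrite mulr1 -mul_polyC -mul_polyC; ring.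
Qed.

(** Local linear independence: a combination that vanishes on the interval has
    a vanishing derivative, so by induction its coefficients agree there, and
    the common value is 0 because the splines sum to 1. *)
Lemma bpoly_free k N c : (k <= l < N)%N -> \sum_(i < N) c i *: bpoly k i = 0 ->
  forall i, (i <= l <= i + k)%N -> c i = 0.
Proof.
elim: k c => [|k IH] c h c0 i hi.
  have lN : (l < N)%N by lia.
  have -> : i = l by lia.
  move/polyP : c0 => /(_ 0%N); rewrite coef_sum coef0.
  rewrite (bigD1 (Ordinal lN))//= eqxx big1 ?addr0.
    by rewrite coefZ coefC eqxx mulr1.
  move=> j jl; rewrite (_ : (j == l :> nat) = false) ?polyC0 ?scaler0 ?coef0//.
  exact/negbTE.
have klN : (k < l < N)%N by lia.
have := deriv_sum_bpoly c klN; rewrite c0 deriv0 => /esym d0.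
have cE j : (j < l <= j + k.+1)%N -> c j = c j.+1.
  move=> hj; have kl : (k <= l < N)%N by lia.
  have hj' : (j.+1 <= l <= j.+1 + k)%N by lia.
  have := IH (fun i => k.+1%:R * (c i - c i.-1) / (xi (i + k.+1) - xi i)) kl d0 j.+1 hj' => /eqP.
  rewrite !mulf_eq0 invr_eq0 pnatr_eq0/= subr_eq0.
  have -> : (xi (j.+1 + k.+1) - xi j.+1 == 0) = false.
    by rewrite gt_eqF// knot_span_gt0//; lia.
  by rewrite orbF => /eqP.
have cl n : (n <= k.+1)%N -> (n <= l)%N -> c (l - n)%N = c l.
  elim: n => [|n IHn] hn nl; first by rewrite subn0.
  rewrite cE; last lia.
  by rewrite -IHn; [congr (c _)|..]; lia.
have cl' j : (j <= l <= j + k.+1)%N -> c j = c l.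
  by move=> hj; rewrite -(cl (l - j)%N); [congr (c _)|..]; lia.
rewrite cl'//; move: c0.
rewrite (_ : \sum_(i < N) _ = c l *: \sum_(i < N) bpoly k.+1 i); last first.
  rewrite scaler_sumr; apply: eq_bigr => j _.
  case hj : (j <= l <= j + k.+1)%N; first by rewrite cl'.
  by rewrite bpoly_out ?hj// !scaler0.
rewrite sum_bpoly1// => /polyP/(_ 0%N).
by rewrite coefZ coefC eqxx mulr1 coef0.
Qed.

End bpoly.

(** * Univariate B-splines with open uniform knots *)

Section bsplines.
Variables (R : realType) (L : R) (m p : nat).
Hypotheses (hL : 0 < L) (hm : (0 < m)%N).
Implicit Types (i k l : nat) (x : R).
Notation xi := (knot L m p).
Notation B := (bspline L m p).

Definition nonempty_cell l := (p <= l < m + p)%N.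
Definition in_cell l x := xi l < x < xi l.+1.
Definition off_knots x := forall k, x != xi k.

Lemma knot_mono : {homo xi : a b / (a <= b)%N >-> a <= b}.
Proof.
move=> a b ab; rewrite /knot ler_pM2r ?invr_gt0 ?ltr0n//.
by rewrite ler_pM2l// ler_nat; lia.
Qed.

Lemma knot_ge0 i : 0 <= xi i.
Proof. by rewrite /knot divr_ge0 ?ler0n// mulr_ge0 ?ler0n// ltW. Qed.

Lemma knot_le i : xi i <= L.
Proof.
rewrite /knot ler_pdivrMr ?ltr0n//; rewrite ler_pM2l// ler_nat; lia.
Qed.

Lemma knot_first i : (i <= p)%N -> xi i = 0.
Proof. by move=> ip; rewrite /knot (_ : (i - p = 0)%N) ?min0n ?mulr0 ?mul0r//; lia. Qed.

Lemma knot_last i : (m + p <= i)%N -> xi i = L.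
Proof.
move=> ip; rewrite /knot (_ : minn _ _ = m); last lia.
by rewrite mulfK// pnatr_eq0; lia.
Qed.

Lemma knot_lt i j : (i < j)%N -> (p < j)%N -> (i < m + p)%N -> xi i < xi j.
Proof.
move=> ij pj im; rewrite /knot ltr_pM2r ?invr_gt0 ?ltr0n//.
by rewrite ltr_pM2l// ltr_nat; lia.
Qed.

Lemma knot_cell l : nonempty_cell l -> xi l < xi l.+1.
Proof. by move=> /andP[h1 h2]; apply: knot_lt; lia. Qed.

Lemma in_cell_box l x : in_cell l x -> 0 < x < L.
Proof.
move=> /andP[h1 h2]; apply/andP; split.
  exact: le_lt_trans (knot_ge0 l) h1.
exact: lt_le_trans h2 (knot_le _).
Qed.

Lemma cell_right x : 0 <= x < L -> exists2 l, nonempty_cell l & xi l <= x < xi l.+1.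
Proof.
move=> /andP[x0 xL].
have P0 : exists k, xi k <= x by exists 0%N; rewrite knot_first.
have Pb k : xi k <= x -> (k <= m + p)%N.
  by move=> kx; rewrite leqNgt; apply/negP => h; move: kx; rewrite knot_last ?leNgt ?xL//; lia.
case: (ex_maxnP P0 Pb) => l lx lmax; have xl : x < xi l.+1.
  by rewrite ltNge; apply/negP => /lmax; rewrite ltnn.
exists l; rewrite ?lx//; apply/andP; split; rewrite leqNgt; apply/negP => h.
  by have := le_lt_trans x0 xl; rewrite knot_first ?ltxx//.
by move: lx; rewrite knot_last ?leNgt ?xL//; lia.
Qed.

Lemma cell_left x : 0 < x <= L -> exists2 l, nonempty_cell l & xi l < x <= xi l.+1.
Proof.
move=> /andP[x0 xL].
have P0 : exists k, xi k < x by exists 0%N; rewrite knot_first.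
have Pb k : xi k < x -> (k <= m + p)%N.
  by move=> kx; rewrite leqNgt; apply/negP => h; move: kx; rewrite knot_last ?ltNge ?xL//; lia.
case: (ex_maxnP P0 Pb) => l lx lmax; have xl : x <= xi l.+1.
  by rewrite leNgt; apply/negP => /lmax; rewrite ltnn.
exists l; rewrite ?lx//; apply/andP; split; rewrite leqNgt; apply/negP => h.
  by have := lt_le_trans x0 xl; rewrite knot_first ?ltxx//.
by move: lx; rewrite knot_last ?ltNge ?xL//; lia.
Qed.

Lemma off_knots_cell x : 0 < x < L -> off_knots x ->
  exists2 l, nonempty_cell l & in_cell l x.
Proof.
move=> /andP[x0 xL] xk; have [|l hl /andP[lx xl]] := @cell_right x.
  by rewrite xL ltW.
by exists l => //; rewrite /in_cell xl lt_neqAle lx eq_sym xk.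
Qed.

(** Inside one knot interval the recursion is that of bpoly, with the same
    convention that a division by 0 gives 0. *)
Lemma bspline_bpoly l k i x : in_cell l x -> B k i x = (bpoly xi l k i).[x].
Proof.
move=> /andP[lx xl]; elim: k i => [|k IH] i /=; last first.
  by rewrite !hornerE /= !IH; ring.
rewrite hornerC; congr (_%:R); have [->|il] := eqVneq i l.
  by rewrite (ltW lx) xl.
rewrite [x == L]lt_eqF ?andbF ?orbF; last exact: lt_le_trans xl (knot_le _).
congr nat_of_bool; apply/negbTE/negP => /andP[ix xi'].
move: il; rewrite neq_ltn => /orP[il|il].
  by have := le_lt_trans (knot_mono il) (lt_trans lx xi'); rewrite ltxx.
by have := le_lt_trans (knot_mono il) (le_lt_trans ix xl); rewrite ltxx.
Qed.

Lemma bspline_cell0 l k i x : in_cell l x -> ~~ (i <= l <= i + k)%N -> B k i x = 0.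
Proof. by move=> lx il; rewrite (bspline_bpoly _ _ lx) bpoly_out ?horner0. Qed.

Lemma bspline_gt0 l k i x : nonempty_cell l -> in_cell l x ->
  (i <= l <= i + k)%N -> 0 < B k i x.
Proof.
move=> hl lx il; rewrite (bspline_bpoly _ _ lx).
exact: (bpoly_gt0 knot_mono (knot_cell hl)).
Qed.

(** The alternative x = L is the last knot interval, which is closed at L. *)
Lemma bspline_support k i x : 0 <= x <= L -> B k i x != 0 ->
  xi i <= x <= xi (i + k.+1) /\ (x < xi (i + k.+1) \/ x = L).
Proof.
move=> /andP[x0 xL]; elim: k i => [|k IH] i /=.
  rewrite pnatr_eq0 eqb0 negbK addn1 => /orP[/andP[ix xi']|/andP[/eqP im /eqP xL']].
    by rewrite ix (ltW xi') xi'; split => //; left.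
  by rewrite xL' knot_le im knot_last ?lexx//; split => //; right.
move=> h; have [|nz] : B k i x != 0 \/ B k i.+1 x != 0.
- have [e1|] := eqVneq (B k i x) 0; last by left.
  have [e2|] := eqVneq (B k i.+1 x) 0; last by right.
  by move: h; rewrite e1 e2 !mulr0 addr0 eqxx.
- move=> /IH[/andP[-> xi'] h']; split.
    by rewrite (le_trans xi')// knot_mono//; lia.
  by case: h' => [h'|->]; [left; rewrite (lt_le_trans h')// knot_mono//; lia|right].
have [/andP[ix xi'] h'] := IH _ nz; rewrite addSnnS in xi' h'; split => //.
by rewrite xi' (le_trans _ ix)// knot_mono//; lia.
Qed.

Lemma bspline_ge0 k i x : 0 <= x <= L -> 0 <= B k i x.
Proof.
move=> xL; elim: k i => [|k IH] i /=; first exact: ler0n.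
have nz j : B k j x = 0 \/ xi j <= x <= xi (j + k.+1).
  have [->|/(bspline_support xL)[? _]] := eqVneq (B k j x) 0; first by left.
  by right.
apply: addr_ge0.
  case: (nz i) => [->|/andP[ix _]]; first by rewrite mulr0.
  by rewrite !mulr_ge0 ?IH ?invr_ge0 ?subr_ge0// knot_mono ?leq_addr.
case: (nz i.+1) => [->|/andP[_ xi']]; first by rewrite mulr0.
rewrite addSn in xi'.
by rewrite !mulr_ge0 ?IH ?invr_ge0 ?subr_ge0// knot_mono//; lia.
Qed.

Lemma bspline_at0 k i : (k <= p)%N -> B k i 0 = (i == p - k)%N%:R.
Proof.
elim: k i => [|k IH] i kp /=.
  rewrite [0 == L]lt_eqF// andbF orbF subn0; congr (_%:R); congr nat_of_bool.
  case: (ltngtP i p) => ip.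
  - by rewrite (@knot_first i.+1) ?ltxx ?andbF//; lia.
  - rewrite leNgt (_ : 0 < xi i)//.
    by rewrite -(@knot_first 0)//; apply: knot_lt; lia.
  - rewrite knot_first ?lexx; last lia.
    by rewrite -[X in X < _](@knot_first 0)// knot_lt//; lia.
rewrite !IH; try lia.
rewrite !sub0r subr0.
have -> : (i == p - k)%N = (i == (p - k.+1).+1) by apply/eqP/eqP; lia.
have [->|ne] := eqVneq i (p - k.+1).+1.
  rewrite knot_first; last lia.
  rewrite oppr0 mul0r mul0r add0r.
  rewrite (_ : ((p - k.+1).+2 == p - k)%N = false); last lia.
  by rewrite (_ : ((p - k.+1).+1 == p - k.+1)%N = false) ?mulr0//; lia.
rewrite mulr0 add0r (_ : (i.+1 == p - k)%N = (i == p - k.+1)%N); last by apply/eqP/eqP; lia.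
have [->|ne'] := eqVneq i (p - k.+1)%N; last by rewrite mulr0.
rewrite (@knot_first (p - k.+1).+1); last lia.
rewrite subr0 mulr1 divff// gt_eqF// -(@knot_first 0)//; apply: knot_lt; lia.
Qed.

Lemma bspline_atL k i : (k <= p)%N -> B k i L = (i.+1 == m + p)%N%:R.
Proof.
elim: k i => [|k IH] i kp /=.
  by rewrite eqxx andbT [L < _]ltNge !knot_le.
rewrite !IH; try lia.
have [im|im] := eqVneq i.+1 (m + p)%N.
  rewrite (_ : (i.+2 == m + p)%N = false) ?mulr0 ?addr0; last lia.
  rewrite mulr1 (@knot_last (i + k.+1)); last lia.
  by rewrite divff// gt_eqF// subr_gt0 -[X in _ < X](@knot_last (m + p)) ?knot_lt//; lia.
rewrite mulr0 add0r; have [im'|im'] := eqVneq i.+2 (m + p)%N; last by rewrite mulr0.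
by rewrite (@knot_last (i + k.+1).+1) ?subrr ?mul0r//; lia.
Qed.

Lemma sum_bspline1 l x : nonempty_cell l -> in_cell l x ->
  \sum_(i < m + p) B p i x = 1.
Proof.
move=> hl lx; rewrite (eq_bigr (fun i : 'I_(m + p) => (bpoly xi l p i).[x])).
  by rewrite -horner_sum (sum_bpoly1 knot_mono (knot_cell hl) hl) hornerC.
by move=> i _; exact: bspline_bpoly.
Qed.

Lemma sum_bspline_greville l x : (0 < p)%N -> nonempty_cell l -> in_cell l x ->
  \sum_(i < m + p) greville L m p i * B p i x = x.
Proof.
move=> hp hl lx; have p0 : p%:R != 0 :> R by rewrite pnatr_eq0 -lt0n.
apply: (mulfI p0); rewrite mulr_sumr -[X in _ = _ * X](hornerX x) -hornerZ.
rewrite -(sum_bpoly_greville knot_mono (knot_cell hl) hl) horner_sum.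
apply: eq_bigr => i _; rewrite hornerZ (bspline_bpoly _ _ lx) /greville.
by rewrite mulrA mulrC [in LHS]mulrC [p%:R * _]mulrC divfK.
Qed.

Lemma measurable_bspline k i : measurable_fun setT (B k i).
Proof.
elim: k i => [|k IH] i /=; last first.
  apply: measurable_funD; apply: measurable_funM => //.
    apply: measurable_funM => //; exact: measurable_funB.
  apply: measurable_funM => //; exact: measurable_funB.
rewrite [X in measurable_fun _ X](_ : _ = fun x =>
  if (xi i <= x) && (x < xi i.+1) || (i.+1 == m + p)%N && (x == L) then 1 else 0).
  apply: measurable_fun_ifT => //; apply: measurable_or.
    by apply: measurable_and; [exact: measurable_fun_ler|exact: measurable_fun_ltr].
  by apply: measurable_and => //; exact: measurable_fun_eqr.
by apply/funext => x; case: ifP.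
Qed.

Lemma bounded_bspline k i : exists C, forall x, 0 <= x <= L -> `|B k i x| <= C.
Proof.
elim: k i => [|k IH] i /=.
  by exists 1 => x _; case: (_ || _); rewrite ?normr1 ?normr0.
have [C1 h1] := IH i; have [C2 h2] := IH i.+1.
exists (L / `|xi (i + k.+1) - xi i| * C1 + L / `|xi (i + k.+1).+1 - xi i.+1| * C2).
move=> x xb; have /andP[x0 xL] := xb.
have bd j : `|x - xi j| <= L.
  have := knot_ge0 j; have := knot_le j; rewrite ler_norml => ? ?; lra.
rewrite (le_trans (ler_normD _ _))// !normrM !normfV.
apply: lerD; apply: ler_pM => //; rewrite ?divr_ge0 ?mulr_ge0 ?invr_ge0//;
  try exact: h1; try exact: h2.
  by rewrite ler_wpM2r ?invr_ge0.
by rewrite ler_wpM2r ?invr_ge0// distrC.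
Qed.


(** The derivative of a B-spline of degree p away from the knots, written with
    B-splines of degree p - 1 so that it is measurable and bounded everywhere. *)
Definition dbspline i x : R :=
  p%:R / (xi (i + p) - xi i) * B p.-1 i x
  - p%:R / (xi (i + p).+1 - xi i.+1) * B p.-1 i.+1 x.

Hypothesis hp : (0 < p)%N.

Lemma dbspline_bpoly l i x : nonempty_cell l -> in_cell l x ->
  dbspline i x = (bpoly xi l p i)^`().[x].
Proof.
move=> hl lx; rewrite /dbspline !(bspline_bpoly _ _ lx).
have -> : bpoly xi l p i = bpoly xi l p.-1.+1 i by rewrite prednK.
rewrite (deriv_bpoly knot_mono (knot_cell hl)) (prednK hp).
by rewrite hornerD hornerN !hornerZ.
Qed.

Lemma dbspline_cell0 l i x : nonempty_cell l -> in_cell l x ->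
  ~~ (i <= l <= i + p)%N -> dbspline i x = 0.
Proof.
by move=> hl lx il; rewrite (dbspline_bpoly _ hl lx) bpoly_out// deriv0 horner0.
Qed.

(** The sum telescopes, and its first term vanishes because the knots 0 to p
    coincide. *)
Lemma sum_dbspline_lt k x :
  \sum_(i < k) dbspline i x = - (p%:R / (xi (k + p) - xi k) * B p.-1 k x).
Proof.
pose F i := - (p%:R / (xi (i + p) - xi i) * B p.-1 i x).
rewrite (eq_bigr (fun i : 'I_k => F i.+1 - F i)); last first.
  by move=> i _; rewrite /F /dbspline addSn; ring.
rewrite -(big_mkord xpredT (fun i => F i.+1 - F i)) telescope_sumr//.
by rewrite /F (@knot_first (0 + p)) ?(@knot_first 0)// subrr invr0 mulr0 mul0r oppr0 subr0.
Qed.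

Lemma sum_dbspline x : \sum_(i < m + p) dbspline i x = 0.
Proof.
rewrite sum_dbspline_lt !knot_last; try lia.
by rewrite subrr invr0 mulr0 mul0r oppr0.
Qed.

Lemma measurable_dbspline i : measurable_fun setT (dbspline i).
Proof.
by apply: measurable_funB; apply: measurable_funM => //; exact: measurable_bspline.
Qed.

Lemma bounded_dbspline i : exists C, forall x, 0 <= x <= L -> `|dbspline i x| <= C.
Proof.
have [C1 h1] := bounded_bspline p.-1 i; have [C2 h2] := bounded_bspline p.-1 i.+1.
exists (`|p%:R / (xi (i + p) - xi i)| * C1 + `|p%:R / (xi (i + p).+1 - xi i.+1)| * C2).
move=> x xb; rewrite (le_trans (ler_normB _ _))// !(normrM _ (B _ _ _)).
by apply: lerD; apply: ler_wpM2l => //; [exact: h1|exact: h2].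
Qed.

(** * Sets of points that determine a spline coefficient *)

Definition separates (S : set R) (i : 'I_(m + p)) :=
  forall c : 'I_(m + p) -> R,
    (forall x, S x -> \sum_k c k * B p k x = 0) -> c i = 0.

Lemma poly_eq0_itv (q : {poly R}) a b : a < b ->
  (forall x, a < x < b -> q.[x] = 0) -> q = 0.
Proof.
move=> ab q0; pose s n := a + (b - a) / (n.+2)%:R.
have sinj : injective s.
  move=> n1 n2 /addrI /mulfI; rewrite gt_eqF ?subr_gt0// => /(_ isT)/invr_inj/eqP.
  by rewrite eqr_nat => /eqP[].
apply: (@roots_geq_poly_eq0 _ _ [seq s n | n <- iota 0 (size q)]).
- apply/allP => _ /mapP[n _ ->]; apply/rootP/q0; rewrite /s ltrDl.
  rewrite divr_gt0 ?subr_gt0//= -ltrBrDl ltr_pdivrMr// ltr_pMr ?subr_gt0//.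
  by rewrite ltr1n.
- by rewrite (map_inj_uniq sinj) iota_uniq.
- by rewrite size_map size_iota.
Qed.

Lemma separates_itv l (i : 'I_(m + p)) a b : nonempty_cell l ->
  (i <= l <= i + p)%N -> a < b -> xi l <= a -> b <= xi l.+1 ->
  separates [set x | a < x < b] i.
Proof.
move=> hl il ab la bl c c0.
pose c' n := if insub n is Some k then c k else 0.
have c'E (k : 'I_(m + p)) : c' k = c k by rewrite /c' insubT//= => ?; congr c; exact/val_inj.
rewrite -c'E; apply: (bpoly_free knot_mono (knot_cell hl) hl _ il).
apply: (poly_eq0_itv ab) => x /andP[ax xb].
have lx : in_cell l x by rewrite /in_cell (le_lt_trans la)// (lt_le_trans xb).
rewrite horner_sum -[RHS](c0 x) /= ?ax//; apply: eq_bigr => k _.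
by rewrite hornerZ c'E (bspline_bpoly _ _ lx).
Qed.

Lemma separates_at0 (i : 'I_(m + p)) : i = 0%N :> nat -> separates [set 0] i.
Proof.
move=> i0 c /(_ 0 erefl); rewrite (bigD1 i)//= big1 ?addr0.
  by rewrite bspline_at0// i0 subnn eqxx mulr1.
move=> k ki; rewrite bspline_at0// subnn (_ : (k == 0 :> nat) = false) ?mulr0//.
by apply: contraNF ki => /eqP k0; apply/eqP/ord_inj; rewrite k0 i0.
Qed.

Lemma separates_atL (i : 'I_(m + p)) : i.+1 = (m + p)%N -> separates [set L] i.
Proof.
move=> iL c /(_ L erefl); rewrite (bigD1 i)//= big1 ?addr0.
  by rewrite bspline_atL// iL eqxx mulr1.
move=> k ki; rewrite bspline_atL// (_ : (k.+1 == m + p)%N = false) ?mulr0//.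
by apply: contraNF ki => /eqP kL; apply/eqP/ord_inj; lia.
Qed.

Definition in_one_cell a b :=
  exists2 l, nonempty_cell l & xi l <= a /\ b <= xi l.+1.

Lemma in_one_cell_box a b : in_one_cell a b -> 0 <= a /\ b <= L.
Proof.
move=> [l _ [la bl]]; split; first exact: le_trans (knot_ge0 l) la.
exact: le_trans bl (knot_le _).
Qed.

Lemma separates_right (i : 'I_(m + p)) x y : xi i <= x < xi (i + p.+1) -> x < y ->
  exists a b, [/\ x <= a, a < b, b <= y, in_one_cell a b &
    separates [set x | a < x < b] i].
Proof.
move=> /andP[ix xi'] xy.
have [|l hl /andP[lx xl]] := @cell_right x.
  by rewrite (le_trans (knot_ge0 _) ix) (lt_le_trans xi' (knot_le _)).
exists x, (Num.min y (xi l.+1)); split => //.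
- by rewrite lt_min xy.
- by rewrite ge_min lexx.
- by exists l => //; rewrite lx ge_min lexx orbT.
apply: (separates_itv hl) => //; rewrite ?lt_min ?xy ?ge_min ?lexx ?orbT//.
apply/andP; split; rewrite leqNgt; apply/negP => h.
  by have := lt_le_trans xl (le_trans (knot_mono h) ix); rewrite ltxx.
have h' : (i + p.+1 <= l)%N by lia.
by have := lt_le_trans xi' (le_trans (knot_mono h') lx); rewrite ltxx.
Qed.

Lemma separates_left (i : 'I_(m + p)) x y : xi i < x <= xi (i + p.+1) -> y < x ->
  exists a b, [/\ y <= a, a < b, b <= x, in_one_cell a b &
    separates [set x | a < x < b] i].
Proof.
move=> /andP[ix xi'] xy.
have [|l hl /andP[lx xl]] := @cell_left x.
  by rewrite (le_lt_trans (knot_ge0 _) ix) (le_trans xi' (knot_le _)).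
exists (Num.max y (xi l)), x; split => //.
- by rewrite le_max lexx.
- by rewrite gt_max xy.
- by exists l => //; rewrite xl le_max lexx orbT.
apply: (separates_itv hl) => //; rewrite ?gt_max ?xy ?le_max ?lexx ?orbT//.
apply/andP; split; rewrite leqNgt; apply/negP => h.
  by have := lt_le_trans ix (le_trans xl (knot_mono h)); rewrite ltxx.
have h' : (i + p.+1 <= l)%N by lia.
by have := lt_le_trans lx (le_trans xi' (knot_mono h')); rewrite ltxx.
Qed.

Lemma separates_near (i : 'I_(m + p)) x e : 0 < e -> 0 <= x <= L -> B p i x != 0 ->
  exists a b, [/\ 0 <= a, a < b, b <= L,
    forall y, a < y < b -> `|y - x| < e & separates [set x | a < x < b] i].
Proof.
move=> e0 xL nz; have [/andP[ix xi'] h] := bspline_support xL nz.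
case: h => [h|xeL].
  have [||a [b [xa ab be /in_one_cell_box[a0 bL] sep]]] := @separates_right i x (x + e).
  - by rewrite ix.
  - by rewrite ltrDl.
  exists a, b; split => //.
  by move=> y /andP[ay yb]; rewrite ger0_norm; lra.
have [||a [b [xa ab be /in_one_cell_box[a0 bL] sep]]] := @separates_left i x (x - e).
- rewrite xi' andbT xeL -[X in _ < X](@knot_last (m + p))//.
  by apply: knot_lt; have := ltn_ord i; lia.
- by rewrite gtrBl.
exists a, b; split => //.
by move=> y /andP[ay yb]; rewrite distrC ger0_norm; lra.
Qed.

(** * Greville abscissae *)

Lemma greville_le i j : (i <= j)%N -> greville L m p i <= greville L m p j.
Proof.
move=> ij; rewrite /greville ler_pM2r ?invr_gt0 ?ltr0n//.
by apply: ler_sum => k _; apply: knot_mono; rewrite leq_add2r.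
Qed.

Let greville_ltS i : (i.+1 < m + p)%N -> greville L m p i < greville L m p i.+1.
Proof.
move=> im; rewrite /greville ltr_pM2r ?invr_gt0 ?ltr0n//.
have -> : \sum_(1 <= k < p.+1) xi (i + k) = xi i.+1 + \sum_(1 <= k < p) xi (i.+1 + k).
  rewrite big_ltn ?addn1//; congr (_ + _).
  by rewrite big_add1; apply: eq_bigr => k _; rewrite addnS addSn.
rewrite (big_nat_recr p) //= addrC ltrD2r; apply: knot_lt; lia.
Qed.

Lemma greville_lt i j : (i < j < m + p)%N -> greville L m p i < greville L m p j.
Proof.
move=> /andP[ij jm]; apply: lt_le_trans (greville_le ij).
by apply: greville_ltS; lia.
Qed.

Let greville_const (c : R) : (\sum_(1 <= k < p.+1) c) / p%:R = c.
Proof.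
by rewrite sumr_const_nat subn1 /= -[c *+ p]mulr_natr mulfK// pnatr_eq0; lia.
Qed.

Lemma knot_le_greville i : xi i <= greville L m p i <= xi (i + p.+1).
Proof.
apply/andP; split.
  rewrite -[X in X <= _](greville_const (xi i)) /greville ler_pM2r ?invr_gt0 ?ltr0n//.
  by apply: ler_sum => k _; apply: knot_mono; lia.
rewrite -[X in _ <= X](greville_const (xi (i + p.+1))).
rewrite /greville ler_pM2r ?invr_gt0 ?ltr0n//.
by apply: ler_sum_nat => k hk; apply: knot_mono; lia.
Qed.

Lemma greville_lt_knot i : (i.+1 < m + p)%N -> greville L m p i < xi (i + p.+1).
Proof.
move=> im; rewrite -(greville_const (xi (i + p.+1))).
rewrite /greville ltr_pM2r ?invr_gt0 ?ltr0n// !(big_ltn (_ : 1 < p.+1)%N)//.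
apply: ltr_leD; first by apply: knot_lt; lia.
by apply: ler_sum_nat => k hk; apply: knot_mono; lia.
Qed.

Lemma knot_lt_greville i : (0 < i < m + p)%N -> xi i < greville L m p i.
Proof.
move=> /andP[i0 im]; rewrite -[X in X < _](greville_const (xi i)).
rewrite /greville ltr_pM2r ?invr_gt0 ?ltr0n// !(big_nat_recr p)//=.
apply: ler_ltD; last by apply: knot_lt; lia.
by apply: ler_sum_nat => k hk; apply: knot_mono; lia.
Qed.

(** The abscissa number i is interior to the support of the i-th B-spline unless
    it is an end point of [0, L]. So next to it, towards any neighbouring
    abscissa, there is a piece of a knot interval inside the support. *)
Lemma separates_greville (i n : 'I_(m + p)) : n = i.+1 :> nat \/ i = n.+1 :> nat ->
  exists a b, [/\ a < b, in_one_cell a b, separates [set x | a < x < b] i &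
    forall x, a < x < b -> exists2 s, 0 <= s <= 1 &
      x = (1 - s) * greville L m p i + s * greville L m p n].
Proof.
have seg (y z x : R) : y < z -> y < x < z ->
    exists2 s, 0 <= s <= 1 & x = (1 - s) * y + s * z.
  move=> yz /andP[yx xz]; have d0 : 0 < z - y by rewrite subr_gt0.
  exists ((x - y) / (z - y)).
    rewrite divr_ge0 ?subr_ge0 ?(ltW yx) ?(ltW yz)//= ler_pdivrMr// mul1r.
    by rewrite lerD2r ltW.
  by field; rewrite gt_eqF.
have /andP[k1 k2] := knot_le_greville i; have ni := ltn_ord n; have ii := ltn_ord i.
case=> [ni1|in1].
  have gl : greville L m p i < greville L m p n by apply: greville_lt; lia.
  have [|a [b [xa ab by_ cell sep]]] := @separates_right i _ _ _ gl.
    by rewrite k1 greville_lt_knot//; lia.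
  exists a, b; split => // x /andP[ax xb]; apply: seg => //.
  by rewrite (le_lt_trans xa ax) (lt_le_trans xb by_).
have gl : greville L m p n < greville L m p i by apply: greville_lt; lia.
have [|a [b [xa ab by_ cell sep]]] := @separates_left i _ _ _ gl.
  by rewrite k2 knot_lt_greville//; lia.
exists a, b; split => // x /andP[ax xb].
have [|s /andP[s0 s1] ->] := seg _ _ x gl.
  by rewrite (le_lt_trans xa ax) (lt_le_trans xb by_).
exists (1 - s); last by ring.
by rewrite subr_ge0 s1 gerBl.
Qed.

End bsplines.

(** * Tensor products *)

Lemma sum_prod_dffun (R : comPzRingType) (I : finType) (T : I -> finType)
    (g : forall i, T i -> R) :
  \sum_(j : {dffun forall i, T i}) \prod_i g i (j i) = \prod_i \sum_(l : T i) g i l.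
Proof.
rewrite (reindex (@dffun_of_fprod I T)); last exact/onW_bij/dffun_of_fprod_bij.
transitivity (\sum_(t : fprod T) \prod_(i in I) [ffun l => g i l] (t i)).
  by apply: eq_bigr => t _; apply: eq_bigr => i _; rewrite !ffunE.
transitivity (\prod_i \sum_(u in tagged_with T i) untag 0 [ffun l => g i l] u).
  by rewrite big_fprod bigA_distr_big_dep.
apply: eq_bigr => i _; rewrite -(big_tag (fun i => [ffun l => g i l])).
by apply: eq_bigr => l _; rewrite ffunE.
Qed.

(** The directions are eliminated one after the other, each by the functional
    that extracts the i-th coefficient from the values on S. *)
Lemma tensor_coef_eq0 (R : comPzRingType) (I : finType) (T : I -> finType)
    (f : forall a, T a -> R -> R) (S : I -> set R) (i : {dffun forall a, T a})
    (c : {dffun forall a, T a} -> R) :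
  (forall a (b : T a -> R),
     (forall x, S a x -> \sum_l b l * f a l x = 0) -> b (i a) = 0) ->
  (forall z, (forall a, S a (z a)) -> \sum_j c j * \prod_a f a (j a) (z a) = 0) ->
  c i = 0.
Proof.
move=> sep c0.
(* s lists the directions already eliminated, in which only the index i is left *)
have step s : forall z, (forall a, a \notin s -> S a (z a)) ->
    \sum_(j : {dffun forall a, T a} | all (fun a => j a == i a) s)
      c j * \prod_(a | a \notin s) f a (j a) (z a) = 0.
  elim: s => [|b s IH] z hz.
    by rewrite -[RHS](c0 z) => [|a]; [apply: eq_bigr|exact: hz].
  have [bs|bs] := boolP (b \in s).
    rewrite -[RHS](IH z) => [|a as_]; last first.
      by apply: hz; rewrite inE negb_or as_ andbT; apply: contraNneq as_ => ->.
    apply: eq_big => j /=.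
      by rewrite andb_idl// => /allP/(_ _ bs).
    move=> _; congr (_ * _); apply: eq_bigl => a.
    by rewrite inE; case: eqVneq => [->|//]; rewrite bs.
  pose C (l : T b) := \sum_(j : {dffun forall a, T a} |
       all (fun a => j a == i a) s && (j b == l))
     c j * \prod_(a | a \notin b :: s) f a (j a) (z a).
  suff : C (i b) = 0.
    by move=> C0; rewrite -[RHS]C0; apply: eq_bigl => j /=; rewrite andbC.
  apply: sep => y Sy.
  rewrite -[RHS](IH (fun a => if a == b then y else z a)); last first.
    move=> a as_; case: eqVneq => [->//|ab]; apply: hz.
    by rewrite inE negb_or ab.
  rewrite [RHS](partition_big (fun j : {dffun forall a, T a} => j b) xpredT)//=.
  apply: eq_bigr => l _; rewrite mulr_suml; apply: eq_bigr => j /andP[_ /eqP jb].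
  rewrite [in RHS](bigD1 b)//= eqxx jb -mulrA; congr (_ * _); rewrite mulrC.
  congr (_ * _); apply: eq_big => [a|a]; first by rewrite inE negb_or andbC.
  by rewrite inE negb_or => /andP[/negbTE->].
rewrite -[RHS](step (enum I) (fun=> 0)) => [|a]; last by rewrite mem_enum.
rewrite (big_pred1 i) => [|j].
  by rewrite big_pred0 ?mulr1// => a; rewrite mem_enum.
apply/allP/eqP => [h|-> //]; apply/ffunP => a; apply/eqP/h.
by rewrite mem_enum.
Qed.

Section tensor_splines.
Variables (R : realType) (n : nat) (m : 'I_n -> nat) (p : nat) (L : 'I_n -> R).
Hypotheses (hm : forall a, (0 < m a)%N) (hL : forall a, 0 < L a) (hp : (0 < p)%N).
Implicit Types (i j : cidx m p) (u v : cval R m p) (z : 'rV[R]_n) (l : 'I_n -> nat).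
Notation B a := (bspline (L a) (m a) p p).
Notation dB a := (dbspline (L a) (m a) p).

Definition in_cells l z :=
  forall a, nonempty_cell (m a) p (l a) /\ in_cell (L a) (m a) p (l a) (z 0 a).

Definition off_grid z := forall a, off_knots (L a) (m a) p (z 0 a).

Lemma off_grid_cells z : open_box L z -> off_grid z -> exists l, in_cells l z.
Proof.
move=> zb zk.
have h a : exists k, nonempty_cell (m a) p k /\ in_cell (L a) (m a) p k (z 0 a).
  by have [k ? ?] := off_knots_cell (hL a) (hm a) (zb a) (zk a); exists k.
by exists (fun a => projT1 (cid (h a))) => a; case: (cid _).
Qed.

Lemma spline_unit i : spline L (unit_cval R i) = tbasis L i.
Proof.
apply/funext => z; rewrite /spline (bigD1 i)//= big1 ?addr0 => [|j ji].
  by rewrite ffunE eqxx mul1r.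
by rewrite ffunE (negbTE ji) mul0r.
Qed.

Lemma splineB u v z : spline L [ffun j => u j - v j] z = spline L u z - spline L v z.
Proof. by rewrite /spline -sumrB; apply: eq_bigr => j _; rewrite ffunE mulrBl. Qed.

Lemma spline_coef_eq0 i u (S : 'I_n -> set R) :
  (forall a, separates (L a) (S a) (i a)) ->
  (forall z, (forall a, S a (z 0 a)) -> spline L u z = 0) -> u i = 0.
Proof.
move=> sep u0; apply: (@tensor_coef_eq0 R 'I_n (fun a => 'I_(m a + p))
  (fun a k => B a k) S i (fun j => u j) sep) => z zS.
rewrite -[RHS](u0 (\row_a z a)) => [|a]; last by rewrite mxE.
by apply: eq_bigr => j _; congr (_ * _); apply: eq_bigr => a _; rewrite mxE.
Qed.

Lemma sum_tbasis1 l z : in_cells l z -> \sum_(j : cidx m p) tbasis L j z = 1.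
Proof.
move=> lz; rewrite (sum_prod_dffun (fun a (k : 'I_(m a + p)) => B a k (z 0 a))) big1// => a _.
by have [h1 h2] := lz a; exact: sum_bspline1 h1 h2.
Qed.

Lemma spline_affine l z c (b : 'rV[R]_n) : in_cells l z ->
  spline L [ffun j : cidx m p => c + dot b (gpoint L j)] z = c + dot b z.
Proof.
move=> lz; rewrite /spline.
under eq_bigr do rewrite ffunE mulrDl.
rewrite big_split -mulr_sumr (sum_tbasis1 lz) mulr1; congr (_ + _).
under eq_bigr do rewrite /dot mulr_suml.
rewrite exchange_big; apply: eq_bigr => a _.
under eq_bigr do rewrite -mulrA mxE.
rewrite -mulr_sumr; congr (_ * _).
pose g c (k : 'I_(m c + p)) :=
  (if c == a then greville (L c) (m c) p k else 1) * B c k (z 0 c).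
rewrite (eq_bigr (fun j : cidx m p => \prod_c g c (j c))) => [|j _].
  rewrite sum_prod_dffun (bigD1 a)//= [X in _ * X]big1 ?mulr1 => [|c' ca].
    rewrite /g eqxx; have [h1 h2] := lz a.
    exact: sum_bspline_greville h1 h2.
  rewrite /g (negbTE ca); under eq_bigr do rewrite mul1r.
  by have [h1 h2] := lz c'; exact: sum_bspline1 h1 h2.
rewrite /g big_split /=; congr (_ * _).
rewrite (bigD1 a)//= eqxx big1 ?mulr1// => c' ca; by rewrite (negbTE ca).
Qed.

Definition dtbasis (a : 'I_n) i z : R :=
  \prod_b (if b == a then dB b (i b) (z 0 b) else B b (i b) (z 0 b)).

Definition dspline (a : 'I_n) u z : R := \sum_i u i * dtbasis a i z.

Lemma dspline_unit a i : dspline a (unit_cval R i) = dtbasis a i.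
Proof.
apply/funext => z; rewrite /dspline (bigD1 i)//= big1 ?addr0 => [|j ji].
  by rewrite ffunE eqxx mul1r.
by rewrite ffunE (negbTE ji) mul0r.
Qed.

(** Along the line through z in direction a the spline is a polynomial near z. *)
Lemma pderiv_spline a u z k : nonempty_cell (m a) p k ->
  in_cell (L a) (m a) p k (z 0 a) -> pderiv a (spline L u) z = dspline a u z.
Proof.
move=> hk zk.
pose q : {poly R} := \sum_i (u i * \prod_(b | b != a) B b (i b) (z 0 b)) *:
  bpoly (knot (L a) (m a) p) k p (i a).
have splineE h : in_cell (L a) (m a) p k (h + z 0 a) ->
    spline L u (h *: delta_mx 0 a + z) = q.[h + z 0 a].
  move=> hz; rewrite /q horner_sum; apply: eq_bigr => i _.
  rewrite hornerZ -mulrA /tbasis (bigD1 a)//= mulrC [in RHS]mulrC; congr (_ * _).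
  rewrite mulrC !mxE !eqxx mulr1 (bspline_bpoly (hL a) (hm a) _ _ hz).
  congr (_ * _); apply: eq_bigr => b ba.
  by rewrite !mxE eqxx (negbTE ba) mulr0 add0r.
have dq : q^`().[z 0 a] = dspline a u z.
  rewrite /q raddf_sum horner_sum; apply: eq_bigr => i _ /=.
  rewrite derivZ hornerZ -mulrA /dtbasis [in RHS](bigD1 a)//= eqxx.
  rewrite (dbspline_bpoly (hL a) (hm a) hp _ hk zk); congr (_ * _).
  by rewrite mulrC; congr (_ * _); apply: eq_bigr => b /negbTE ->.
rewrite -dq /pderiv /derive; apply/cvg_lim => //.
have [dq1 dq2] := is_derive_poly q (z 0 a).
move: dq1; rewrite /derivable -dq2 /derive => qcvg.
apply: cvg_trans qcvg; apply: near_eq_cvg; near=> h => /=.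
have z0 : in_cell (L a) (m a) p k (0 + z 0 a) by rewrite add0r.
have hz : in_cell (L a) (m a) p k (h + z 0 a).
  near: h. apply: nbhs_dnbhs.
  have /andP[zk1 zk2] := zk.
  exists (Num.min (z 0 a - knot (L a) (m a) p k) (knot (L a) (m a) p k.+1 - z 0 a)).
    by rewrite /= lt_min !subr_gt0 zk1.
  move=> h /=; rewrite sub0r normrN lt_min => /andP[h1 h2].
  rewrite /in_cell; move: h1 h2; rewrite !ltr_norml => /andP[? ?] /andP[? ?].
  apply/andP; split; lra.
have := splineE _ z0; rewrite scale0r !add0r => ->.
by rewrite /shift /= splineE// /GRing.scale /= mulr1.
Unshelve. all: by end_near.
Qed.

End tensor_splines.

(** * Integrals over the space--time box *)

Section integral_off_null_sets.
Local Open Scope ereal_scope.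
Context d (T : measurableType d) (R : realType) (mu : {measure set T -> \bar R}).
Implicit Types (f g : T -> \bar R) (N D : set T).
Import HBNNSimple.

Let le_integral_off N f g : measurable N -> mu N = 0 ->
  (forall x, 0 <= f x) -> (forall x, 0 <= g x) -> (forall x, ~ N x -> f x = g x) ->
  \int[mu]_x f x <= \int[mu]_x g x.
Proof.
move=> mN N0 f0 g0 fg; rewrite [leLHS]ge0_integralTE// [leRHS]ge0_integralTE//.
apply: ge_ereal_sup => _ [h /= hf <-].
pose h' := mul_nnsfun h (indic_nnsfun R (measurableC mN)).
have h'E x : h' x = (h x * \1_(~` N) x)%R by [].
have -> : sintegral mu h = sintegral mu h'.
  have E (k : {nnsfun T >-> R}) : sintegral mu k = \int[mu]_x (k x)%:E.
    by rewrite integral_nnsfun// patch_setT.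
  rewrite !E; apply: ae_eq_integral => //.
  - exact/measurable_EFinP.
  - exact/measurable_EFinP.
  exists N; split => // x /= /not_implyP[_]; apply: contra_notP => Nx.
  by rewrite -[X in _ = X%:E]/(h' x) h'E indicE mem_set// mulr1.
apply: ereal_sup_ubound; exists h' => // x.
rewrite h'E indicE; case: (pselect (N x)) => Nx.
  by rewrite memNset ?mulr0//= => /(_ Nx).
by rewrite mem_set// mulr1 -fg.
Qed.

(** Meant for integrands that contain pointwise derivatives, about which nothing
    is known on the knot hyperplanes, not even measurability: a simple function
    keeps its integral when it is replaced by 0 on a null set, so the supremum
    that defines the integral does not see the values there. *)
Lemma eq_integral_off_null N D f g : measurable N -> mu N = 0 ->
  (forall x, D x -> ~ N x -> f x = g x) ->
  \int[mu]_(x in D) f x = \int[mu]_(x in D) g x.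
Proof.
move=> mN N0 fg.
have h x : ~ N x -> (f \_ D) x = (g \_ D) x.
  by move=> Nx; rewrite !patchE; case: ifP => // /[1!inE] Dx; exact: fg.
rewrite integral_mkcond [RHS]integral_mkcond integralE [RHS]integralE.
congr (_ - _); apply/eqP; rewrite eq_le; apply/andP; split;
  apply: (le_integral_off mN N0) => //; move=> x Nx; rewrite ?funeposE ?funenegE h//.
Qed.

End integral_off_null_sets.

Section tuple_boxes.
Local Open Scope ereal_scope.
Variable (R : realType).

Lemma measurable_tuple_box n (A : 'I_n -> set (measurableTypeR R)) : (forall a, measurable (A a)) ->
  measurable [set t : n.-tuple (measurableTypeR R) | forall a, A a (tnth t a)].
Proof.
move=> mA; rewrite (_ : [set _ | _] =
    \bigcap_(a in [set: 'I_n]) ((fun t : n.-tuple (measurableTypeR R) => tnth t a) @^-1` A a)).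
  apply: fin_bigcap_measurable => // a _.
  by rewrite -[X in measurable X]setTI; exact: measurable_tnth.
by apply/seteqP; split => [t h a _|t h a]; [exact: h|exact: (h a I)].
Qed.

Lemma lebesgue_tuple_box n (A : 'I_n -> set (measurableTypeR R)) : (forall a, measurable (A a)) ->
  lebesgue_tuple R n [set t | forall a, A a (tnth t a)] =
  \prod_(a < n) lebesgue_measure (A a).
Proof.
elim: n A => [|n IH] A mA.
  rewrite big_ord0 /lebesgue_tuple /= /dirac indicE mem_set//; by case.
rewrite big_ord_recl -IH//.
rewrite /lebesgue_tuple /= /tcons_measure /pushforward -product_measure1E//.
  congr (_ _); apply/seteqP; split => [[x t] /= h|[x t] /= [h1 h2] a].
    split => [|a]; first by have := h ord0; rewrite (tnth_nth point).
    by have := h (lift ord0 a); rewrite !(tnth_nth point).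
  case: (unliftP ord0 a) => [k|] ->; rewrite (tnth_nth point)//.
  by have := h2 k; rewrite (tnth_nth point).
exact: (@measurable_tuple_box _ (fun a => A (lift ord0 a))).
Qed.

Definition grid_tuples n (s : 'I_n -> nat -> R) : set (n.-tuple (measurableTypeR R)) :=
  [set t | exists a k, tnth t a = s a k].

Let hyperplane_box n (s : 'I_n -> nat -> R) (a : 'I_n) k :
  [set t : n.-tuple (measurableTypeR R) | tnth t a = s a k] =
  [set t | forall b, (if b == a then [set s a k] else setT) (tnth t b)].
Proof.
apply/seteqP; split => t /= => [ta b|/(_ a)]; last by rewrite eqxx.
by case: eqVneq => [->|].
Qed.

Let measurable_hyperplane n (s : 'I_n -> nat -> R) (a : 'I_n) k :
  measurable [set t : n.-tuple (measurableTypeR R) | tnth t a = s a k].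
Proof.
rewrite hyperplane_box.
by apply: (@measurable_tuple_box _ (fun b => if b == a then _ else _)) => b; case: ifP.
Qed.

Let grid_tuplesE n (s : 'I_n -> nat -> R) :
  grid_tuples s = \bigcup_i (if unpickle i is Some (a, k) then
    [set t : n.-tuple (measurableTypeR R) | tnth t a = s a k] else set0).
Proof.
apply/seteqP; split => t.
  by move=> [a [k tak]]; exists (pickle (a, k)) => //; rewrite pickleK.
by move=> [i _]; case: unpickle => [[a k]|//] /= tak; exists a, k.
Qed.

Lemma measurable_grid n (s : 'I_n -> nat -> R) : measurable (grid_tuples s).
Proof.
rewrite grid_tuplesE; apply: bigcup_measurable => i _.
by case: unpickle => [[a k]|]; [exact: measurable_hyperplane|exact: measurable0].
Qed.

Lemma grid_null n (s : 'I_n -> nat -> R) :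
  lebesgue_tuple R n (grid_tuples s) = 0.
Proof.
have h a k : lebesgue_tuple R n [set t | tnth t a = s a k] = 0.
  rewrite hyperplane_box (@lebesgue_tuple_box _ (fun b => if b == a then _ else _)).
    by rewrite (bigD1 a)//= eqxx lebesgue_measure_set1 mul0e.
  by move=> b; case: ifP.
apply: measure_negligible; first exact: measurable_grid.
rewrite grid_tuplesE; apply: negligible_bigcup => i.
case: unpickle => [[a k]|]; last exact: negligible_set0.
by apply/negligibleP; [exact: measurable_hyperplane|exact: h].
Qed.
End tuple_boxes.

(** An open set of row vectors is a countable union of cubes with rational
    centres, and those lie in the product sigma-algebra on tuples. *)
Lemma measurable_open_tuples (R : realType) n (U : set 'rV[R]_n) : open U ->
  measurable [set t : n.-tuple (measurableTypeR R) | U (\row_a tnth t a)].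
Proof.
move=> /= oU.
pose cube (c : {ffun 'I_n -> rat}) (k : nat) : set 'rV[R]_n :=
  [set z | forall a, z 0 a \in `](ratr (c a) - k.+1%:R^-1), (ratr (c a) + k.+1%:R^-1)[].
rewrite (_ : [set t | _] = \bigcup_i (if unpickle i is Some (c, k) then
    if `[< cube c k `<=` U >] then
      [set t : n.-tuple (measurableTypeR R) | forall a,
        [set` `](ratr (c a) - k.+1%:R^-1), (ratr (c a) + k.+1%:R^-1)[] (tnth t a)]
    else set0 else set0)); last first.
  apply/seteqP; split => t /=.
    move=> Ut; have /nbhs_ballP[e /= e0 eU] := oU _ Ut.
    have [k ke] : exists k, k.+1%:R^-1 < e / 2.
      have [k hk] := ltr_add_invr (divr_gt0 e0 (ltr0Sn R 1)).
      by exists k; rewrite add0r in hk.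
    have h a : exists q : rat, ratr q \in `](tnth t a - k.+1%:R^-1), (tnth t a + k.+1%:R^-1)[.
      apply: rat_in_itvoo; rewrite ltrD2l gt0_cp ?invr_gt0 ?ltr0n//.
    pose c : {ffun 'I_n -> rat} := [ffun a => projT1 (cid (h a))].
    have ct a : `|ratr (c a) - tnth t a| < k.+1%:R^-1.
      rewrite ffunE; case: cid => q /=; rewrite in_itv /= => /andP[h1 h2].
      by rewrite ltr_distl h1 h2.
    exists (pickle (c, k)) => //; rewrite pickleK; case: asboolP => [_|].
      by move=> a /=; rewrite in_itv /= -ltr_distl distrC.
    case => z zc; apply: eU; split => // i a; rewrite ord1 mxE /ball /=.
    have := zc a; rewrite in_itv /= -ltr_distl => zca.
    rewrite (le_lt_trans (ler_distD (ratr (c a)) _ _))// [ltRHS]splitr.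
    by rewrite ltrD ?(lt_trans _ ke)// distrC.
  move=> [i _]; case: unpickle => [[c k]|//]; case: asboolP => // cU h.
  by apply: cU => a; rewrite mxE; exact: h.
apply: bigcup_measurable => i _; case: unpickle => [[c k]|]; last exact: measurable0.
case: ifP => _; last exact: measurable0.
apply: (@measurable_tuple_box _ _ (fun a =>
  [set` `](ratr (c a) - k.+1%:R^-1), (ratr (c a) + k.+1%:R^-1)[])) => a.
exact: measurable_itv.
Qed.

Section box_integral.
Variables (R : realType) (n : nat) (L : 'I_n -> R).
Implicit Types (f g : 'rV[R]_n -> R) (t : n.-tuple (measurableTypeR R)) (z : 'rV[R]_n).
Notation row t := (\row_a tnth t a).
Notation mu := (lebesgue_tuple R n).

Definition tuple_box : set (n.-tuple (measurableTypeR R)) := [set t | open_box L (row t)].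

Lemma tuple_boxE :
  tuple_box = [set t | forall a, [set` `]0, L a[] (tnth t a)].
Proof.
by apply/seteqP; split => t h a; have := h a; rewrite /= in_itv /= mxE.
Qed.

Lemma measurable_tuple_box_open : measurable tuple_box.
Proof.
rewrite tuple_boxE; apply: (@measurable_tuple_box _ _ (fun a => [set` `]0, L a[])) => a.
exact: measurable_itv.
Qed.

Lemma tuple_box_fin : (mu tuple_box < +oo)%E.
Proof.
rewrite tuple_boxE (@lebesgue_tuple_box _ _ (fun a => [set` `]0, L a[])) => [|a];
  last exact: measurable_itv.
suff [r [_ ->]] : exists r : R, 0 <= r /\ (\prod_(a < n)
    (@lebesgue_measure R) [set` `]0%R, L a[%R])%E = r%:E by rewrite ltry.
apply: (big_ind (fun x : \bar R => exists r : R, 0 <= r /\ x = r%:E)).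
- by exists 1.
- move=> _ _ [r [r0 ->]] [s [s0 ->]]; exists (r * s); split; [exact: mulr_ge0|by rewrite EFinM].
- move=> a _; rewrite lebesgue_measure_itv /=; case: ifP => [|_]; last by exists 0.
  by rewrite lte_fin => La; exists (L a); rewrite ltW// sube0.
Qed.

Definition bounded_measurable f :=
  measurable_fun tuple_box (fun t => f (row t)) /\
  exists C, forall z, open_box L z -> `|f z| <= C.

Lemma bounded_measurable_cst c : bounded_measurable (fun=> c).
Proof. by split; [exact: measurable_cst|exists `|c|]. Qed.

Lemma bounded_measurableD f g : bounded_measurable f -> bounded_measurable g ->
  bounded_measurable (fun z => f z + g z).
Proof.
move=> [mf [C fC]] [mg [C' gC]]; split; first exact: measurable_funD.
exists (C + C') => z zb; rewrite (le_trans (ler_normD _ _))// lerD//; [exact: fC|exact: gC].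
Qed.

Lemma bounded_measurableM f g : bounded_measurable f -> bounded_measurable g ->
  bounded_measurable (fun z => f z * g z).
Proof.
move=> [mf [C fC]] [mg [C' gC]]; split; first exact: measurable_funM.
exists (C * C') => z zb; rewrite normrM ler_pM//; [exact: fC|exact: gC].
Qed.

Lemma bounded_measurable_sum (I : Type) (s : seq I) (f : I -> 'rV[R]_n -> R) :
  (forall i, bounded_measurable (f i)) ->
  bounded_measurable (fun z => \sum_(i <- s) f i z).
Proof.
move=> h; elim: s => [|i s IH].
  under eq_fun do rewrite big_nil; exact: bounded_measurable_cst.
by under eq_fun do rewrite big_cons; exact: bounded_measurableD.
Qed.

Lemma bounded_measurable_prod (I : Type) (s : seq I) (f : I -> 'rV[R]_n -> R) :
  (forall i, bounded_measurable (f i)) ->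
  bounded_measurable (fun z => \prod_(i <- s) f i z).
Proof.
move=> h; elim: s => [|i s IH].
  under eq_fun do rewrite big_nil; exact: bounded_measurable_cst.
by under eq_fun do rewrite big_cons; exact: bounded_measurableM.
Qed.

Lemma bounded_measurable_coord (a : 'I_n) (h : R -> R) : measurable_fun setT h ->
  (exists C, forall x, 0 <= x <= L a -> `|h x| <= C) ->
  bounded_measurable (fun z => h (z 0 a)).
Proof.
move=> mh [C hC]; split; last first.
  by exists C => z zb; apply: hC; have /andP[/ltW-> /ltW->] := zb a.
under eq_fun do rewrite mxE.
apply: (measurableT_comp mh); apply: measurable_funTS; exact: measurable_tnth.
Qed.

Lemma bounded_measurable_integrable f : bounded_measurable f ->
  mu.-integrable tuple_box (EFin \o (fun t => f (row t))).
Proof.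
move=> [mf [C fC]]; apply: measurable_bounded_integrable => //.
- exact: measurable_tuple_box_open.
- exact: tuple_box_fin.
exists C; split; first exact: num_real.
by move=> M CM t tb /=; rewrite (le_trans (fC _ tb))// ltW.
Qed.

Lemma box_integralD f g : bounded_measurable f -> bounded_measurable g ->
  box_integral L (fun z => f z + g z) = box_integral L f + box_integral L g.
Proof.
move=> bf bg; rewrite /box_integral RintegralD//.
- exact: measurable_tuple_box_open.
- exact: bounded_measurable_integrable bf.
- exact: bounded_measurable_integrable bg.
Qed.

Lemma box_integralZ c f : bounded_measurable f ->
  box_integral L (fun z => c * f z) = c * box_integral L f.
Proof.
move=> bf; rewrite /box_integral RintegralZl//.
- exact: measurable_tuple_box_open.
- exact: bounded_measurable_integrable bf.
Qed.

Lemma box_integral0 f : (forall z, open_box L z -> f z = 0) -> box_integral L f = 0.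
Proof.
by move=> f0; rewrite /box_integral /Rintegral integral0_eq// => t tb; rewrite f0.
Qed.

Lemma box_integral_sum (I : Type) (s : seq I) (f : I -> 'rV[R]_n -> R) :
  (forall i, bounded_measurable (f i)) ->
  box_integral L (fun z => \sum_(i <- s) f i z) = \sum_(i <- s) box_integral L (f i).
Proof.
move=> h; elim: s => [|i s IH].
  by rewrite big_nil box_integral0// => z _; rewrite big_nil.
rewrite big_cons -IH -box_integralD//; last exact: bounded_measurable_sum.
by congr (box_integral _ _); apply/funext => z; rewrite big_cons.
Qed.

Lemma eq_box_integral (s : 'I_n -> nat -> R) f g :
  (forall z, open_box L z -> (forall a k, z 0 a != s a k) -> f z = g z) ->
  box_integral L f = box_integral L g.
Proof.
move=> fg; rewrite /box_integral /Rintegral; congr fine.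
apply: (@eq_integral_off_null _ _ R mu (grid_tuples s)) => [||t tb tN].
- exact: measurable_grid.
- exact: grid_null.
congr _%:E; apply: fg => // a k; rewrite mxE; apply/eqP => h.
by apply: tN; exists a, k.
Qed.

Lemma box_integral_gt0 f (l r : 'I_n -> R) : bounded_measurable f ->
  (forall z, open_box L z -> 0 <= f z) -> (forall a, l a < r a) ->
  (forall z, (forall a, l a < z 0 a < r a) -> open_box L z /\ 0 < f z) ->
  0 < box_integral L f.
Proof.
move=> bf f0 lr fE; have [mf _] := bf.
have fin := integrable_fin_num measurable_tuple_box_open (bounded_measurable_integrable bf).
rewrite lt_neqAle Rintegral_ge0 ?andbT//; last by move=> t tb; exact: f0.
apply/eqP => /esym/eqP; rewrite /box_integral /Rintegral fine_eq0// => /eqP i0.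
have : ae_eq mu tuple_box (EFin \o (fun t => f (row t))) (cst 0%E).
  apply/ae_eq_integral_abs.
  - exact: measurable_tuple_box_open.
  - exact/measurable_EFinP.
  rewrite -[RHS]i0; apply: eq_integral => t /[!inE] tb /=.
  by rewrite ger0_norm// f0.
move=> [N [mN N0 sub]].
pose E := [set t : n.-tuple (measurableTypeR R) | forall a, [set` `]l a, r a[] (tnth t a)].
have mE : measurable E.
  by apply: (@measurable_tuple_box _ _ (fun a => [set` `]l a, r a[])) => a; exact: measurable_itv.
have EN : E `<=` N.
  move=> t Et; apply: sub => /=.
  have [tb ft] : open_box L (row t) /\ 0 < f (row t).
    by apply: fE => a; rewrite mxE; have := Et a; rewrite /= in_itv.
  by move=> /(_ tb) /eqP; rewrite eqe gt_eqF.
have : mu E = 0%E by apply: subset_measure0 EN _ => //.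
rewrite /E (@lebesgue_tuple_box _ _ (fun a => [set` `]l a, r a[])) => [|a];
  last exact: measurable_itv.
apply/eqP; apply: (big_ind (fun x : \bar R => x != 0%E)) => //.
- by move=> x y x0 y0; rewrite mule_neq0.
- by move=> a _; rewrite lebesgue_measure_itv /= lte_fin lr eqe subr_eq0 gt_eqF.
Qed.

Lemma bounded_measurable_continuous f :
  (forall z, open_box L z -> {for z, continuous f}) ->
  (exists C, forall z, open_box L z -> `|f z| <= C) -> bounded_measurable f.
Proof.
move=> cf bf; split => // _.
apply: (measurability _ (RGenOInfty.measurableE R)) => //;
  last exact: measurable_tuple_box_open.
move=> /= _ [_ [c ->] <-]; rewrite preimage_itvoy.
rewrite (_ : _ `&` _ = [set t | [set z | open_box L z /\ c < f z] (row t)])//.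
apply: measurable_open_tuples; rewrite openE => z [zb cz].
have : \forall y \near z, open_box L y.
  apply: (@filter_forall _ _ (fun a (y : 'rV[R]_n) => 0 < y 0 a < L a) _ (nbhs_filter z)) => a.
  have : {for z, continuous (fun y : 'rV[R]_n => y 0 a)} by exact: coord_continuous.
  have /andP[z0 zL] := zb a.
  move=> ca; near=> y; apply/andP; split; near: y.
    exact: (ca [set x | 0 < x] (lt_nbhsr z0)).
  exact: (ca [set x | x < L a] (lt_nbhsl zL)).
have : \forall y \near z, c < f y by exact: (cf z zb [set x | c < x] (lt_nbhsr cz)).
by apply: filterS2.
Unshelve. all: by end_near.
Qed.

End box_integral.

(** * The Galerkin matrix *)

Section galerkin.
Variables (R : realType) (d p : nat) (m : 'I_d.+1 -> nat) (L : 'I_d.+1 -> R).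
Variables (mu : R) (beta : 'rV[R]_d -> 'rV[R]_d).
Hypotheses (hm : forall a, (0 < m a)%N) (hL : forall a, 0 < L a) (hp : (0 < p)%N).
Hypothesis hbeta : velocity_C1 L beta.
Implicit Types (i j : cidx m p) (u v c : cval R m p) (z : 'rV[R]_d.+1) (a b : 'I_d.+1).
Notation t := (ord_max : 'I_d.+1).
Notation sp := (@space_dir d).
Notation off := (off_grid m p L).
Notation bm := (bounded_measurable L).

Lemma box_closed z : open_box L z -> closed_box (L_space L) (space_part z).
Proof.
by move=> zb k; rewrite mxE; have /andP[/ltW-> /ltW->] := zb (sp k).
Qed.

Lemma velocity_continuous x (k : 'I_d) : closed_box (L_space L) x ->
  {for x, continuous (fun y => beta y 0 k)}.
Proof.
move=> xb; apply: (@continuous_comp _ _ _ beta (fun y : 'rV[R]_d => y 0 k)).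
  exact: differentiable_continuous (hbeta.1 x xb).
exact: coord_continuous.
Qed.

Lemma continuous_space_part : continuous (@space_part R d).
Proof.
move=> z A /nbhs_ballP[e /= e0 eA]; apply/nbhs_ballP; exists e => // y [_ zy].
by apply: eA; split => // i a; rewrite !mxE; exact: zy.
Qed.

Lemma bm_velocity k : bm (fun z => beta (space_part z) 0 k).
Proof.
apply: bounded_measurable_continuous => [z zb|].
  apply: (@continuous_comp _ _ _ (@space_part R d) (fun y : 'rV[R]_d => beta y 0 k)).
    exact: continuous_space_part.
  exact/velocity_continuous/box_closed.
have boxE : closed_box (L_space L) =
    [set v : 'rV[R]_d | forall l, [set` `[0, L_space L l]] (v ord0 l)].
  by apply/seteqP; split => x h a; have := h a; rewrite /= in_itv.
have cbox : compact (closed_box (L_space L)).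
  rewrite boxE; apply: (@rV_compact _ _ (fun l => [set` `[0, L_space L l]])) => a.
  exact: segment_compact.
have : compact ((fun y => beta y 0 k) @` closed_box (L_space L)).
  apply: continuous_compact cbox; apply: continuous_in_subspaceT => x /[!inE].
  exact: velocity_continuous.
move=> /compact_bounded/pinfty_ex_gt0[C _ hC]; exists C => z zb.
by apply: hC; exists (space_part z) => //; exact: box_closed.
Qed.

Lemma bm_spline u : bm (spline L u).
Proof.
apply: bounded_measurable_sum => i; apply: bounded_measurableM.
  exact: bounded_measurable_cst.
apply: bounded_measurable_prod => a.
apply: (bounded_measurable_coord (h := bspline (L a) (m a) p p (i a))).
  exact: measurable_bspline.
exact: bounded_bspline.
Qed.

Lemma bm_dspline a u : bm (dspline L a u).
Proof.
apply: bounded_measurable_sum => i; apply: bounded_measurableM.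
  exact: bounded_measurable_cst.
apply: bounded_measurable_prod => b; case: (b == a).
  apply: (bounded_measurable_coord (h := dbspline (L b) (m b) p (i b))).
    exact: measurable_dbspline.
  exact: bounded_dbspline.
apply: (bounded_measurable_coord (h := bspline (L b) (m b) p p (i b))).
  exact: measurable_bspline.
exact: bounded_bspline.
Qed.

Lemma eq_box_integral_grid f g : (forall z, open_box L z -> off z -> f z = g z) ->
  box_integral L f = box_integral L g.
Proof. exact: (eq_box_integral (s := fun a k => knot (L a) (m a) p k)). Qed.

Lemma pderiv_spline_off a u z : open_box L z -> off z ->
  pderiv a (spline L u) z = dspline L a u z.
Proof.
move=> zb zk; have [k hk zc] := off_knots_cell (hL a) (hm a) (zb a) (zk a).
exact: pderiv_spline zc.
Qed.

(** The Galerkin form of two splines with the derivatives written out, which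
    is linear in u without any differentiability. *)
Definition spline_galerkin u v : R :=
  box_integral L (fun z => dspline L t u z * spline L v z)
  + \sum_(k < d) box_integral L (fun z =>
      dspline L (sp k) u z * (beta (space_part z) 0 k * spline L v z))
  + mu * \sum_(k < d) box_integral L (fun z =>
      dspline L (sp k) u z * dspline L (sp k) v z).

Lemma galerkin_spline u v :
  galerkin L mu beta (spline L u) (spline L v) = spline_galerkin u v.
Proof.
rewrite /galerkin /inner; congr (_ + _ + _ * _).
- by apply: eq_box_integral_grid => z zb zk; rewrite /dt pderiv_spline_off.
- rewrite -box_integral_sum => [|k]; last first.
    apply: bounded_measurableM; first exact: bm_dspline.
    by apply: bounded_measurableM; [exact: bm_velocity|exact: bm_spline].
  apply: eq_box_integral_grid => z zb zk; rewrite mulr_suml.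
  by apply: eq_bigr => k _; rewrite pderiv_spline_off//; ring.
- apply: eq_bigr => k _; apply: eq_box_integral_grid => z zb zk.
  by rewrite !pderiv_spline_off.
Qed.

Notation K := (Kmat L mu beta).

Lemma KmatE i j : K i j = spline_galerkin (unit_cval R j) (unit_cval R i).
Proof. by rewrite -galerkin_spline !spline_unit. Qed.

Lemma dspline_integral_sum a c g : bm g ->
  box_integral L (fun z => dspline L a c z * g z) =
  \sum_j c j * box_integral L (fun z => dspline L a (unit_cval R j) z * g z).
Proof.
move=> bg.
under [RHS]eq_bigr => j _.
  rewrite -box_integralZ; last by apply: bounded_measurableM => //; exact: bm_dspline.
  over.
rewrite -box_integral_sum => [|j].
  congr box_integral; apply/funext => z; rewrite /dspline mulr_suml.
  apply: eq_bigr => j _; rewrite -mulrA; congr (_ * (_ * _)).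
  by rewrite -[RHS]/(dspline L a (unit_cval R j) z) dspline_unit.
apply: bounded_measurableM; first exact: bounded_measurable_cst.
by apply: bounded_measurableM => //; exact: bm_dspline.
Qed.

Lemma sum_Kmat c i : \sum_j c j * K i j = spline_galerkin c (unit_cval R i).
Proof.
under eq_bigr do rewrite KmatE !mulrDr.
rewrite !big_split /= /spline_galerkin; congr (_ + _ + _).
- by rewrite dspline_integral_sum//; exact: bm_spline.
- under eq_bigr do rewrite mulr_sumr.
  rewrite exchange_big; apply: eq_bigr => k _.
  rewrite dspline_integral_sum//.
  by apply: bounded_measurableM; [exact: bm_velocity|exact: bm_spline].
- under eq_bigr do rewrite mulrCA mulr_sumr.
  rewrite -mulr_sumr exchange_big; congr (_ * _); apply: eq_bigr => k _.
  by rewrite dspline_integral_sum//; exact: bm_dspline.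
Qed.

Lemma dtbasis_support l z a j : in_cells m p L l z -> dtbasis L a j z != 0 ->
  forall b, (j b <= l b <= j b + p)%N.
Proof.
move=> lz nz b; apply: contraNT nz => jb; have [hl zl] := lz b.
rewrite /dtbasis (bigD1 b)//= (bspline_cell0 (hL b) (hm b) zl jb).
by rewrite (dbspline_cell0 (hL b) (hm b) hp hl zl jb) if_same mul0r.
Qed.

Lemma tbasis_support l z j : in_cells m p L l z -> tbasis L j z != 0 ->
  forall b, (j b <= l b <= j b + p)%N.
Proof.
move=> lz nz b; apply: contraNT nz => jb; have [hl zl] := lz b.
by rewrite /tbasis (bigD1 b)//= (bspline_cell0 (hL b) (hm b) zl jb) mul0r.
Qed.

Lemma box_integral_grid0 f : (forall z, open_box L z -> off z -> f z = 0) ->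
  box_integral L f = 0.
Proof. by move=> f0; rewrite (eq_box_integral_grid f0) box_integral0. Qed.

Lemma Kmat_sparse i j : j \notin Sh i -> K i j = 0.
Proof.
move=> jS.
have far (x y : R) l : (x != 0 -> forall b, (j b <= l b <= j b + p)%N) ->
    (y != 0 -> forall b, (i b <= l b <= i b + p)%N) -> x * y = 0.
  move=> hj hi; apply/eqP; apply: contraNT jS; rewrite mulf_eq0 negb_or => /andP[x0 y0].
  rewrite inE; apply/forallP => b.
  by have := hj x0 b; have := hi y0 b; lia.
rewrite KmatE /spline_galerkin spline_unit box_integral_grid0 => [|z zb zk]; last first.
  have [l lz] := off_grid_cells hm hL zb zk.
  by rewrite dspline_unit; apply: (far _ _ l); [exact: dtbasis_support lz|exact: tbasis_support lz].
rewrite !big1 ?mulr0 ?addr0// => k _; apply: box_integral_grid0 => z zb zk.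
  have [l lz] := off_grid_cells hm hL zb zk.
  by rewrite !dspline_unit; apply: (far _ _ l); exact: dtbasis_support lz.
have [l lz] := off_grid_cells hm hL zb zk.
rewrite dspline_unit mulrCA (far (dtbasis L (sp k) j z) _ l) ?mulr0//.
  exact: dtbasis_support lz.
exact: tbasis_support lz.
Qed.

(** In every other direction the basis functions sum to 1, so only the
    telescoping sum of the derivatives in time is left. *)
Lemma dspline_time_lt l z a k : in_cells m p L l z -> (k <= m t + p)%N ->
  dspline L a [ffun j : cidx m p => (j t < k)%N%:R] z =
  if a == t then - (p%:R / (knot (L t) (m t) p (k + p) - knot (L t) (m t) p k)
                    * bspline (L t) (m t) p p.-1 k (z 0 t)) else 0.
Proof.
move=> lz kt.
pose g b (n : 'I_(m b + p)) : R := (if b == t then (n < k)%N%:R else 1) *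
  (if b == a then dbspline (L b) (m b) p n (z 0 b) else bspline (L b) (m b) p p n (z 0 b)).
transitivity (\prod_b \sum_n g b n).
  rewrite -sum_prod_dffun; apply: eq_bigr => j _; rewrite ffunE /g big_split /=.
  congr (_ * _); rewrite (bigD1 t)//= eqxx big1 ?mulr1// => b /negbTE ->.
  by [].
case: (eqVneq a t) => at_.
  rewrite (bigD1 t)//= [X in _ * X]big1 ?mulr1 => [|b bt]; last first.
    rewrite /g at_ (negbTE bt); under eq_bigr do rewrite mul1r.
    by have [h1 h2] := lz b; exact: sum_bspline1 h1 h2.
  rewrite -sum_dbspline_lt// (big_ord_widen _ (fun n => dbspline (L t) (m t) p n (z 0 t)) kt).
  rewrite [RHS]big_mkcond; apply: eq_bigr => n _; rewrite /g at_ eqxx.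
  by case: ifP; rewrite ?mul1r ?mul0r.
rewrite (bigD1 a)//= /g eqxx (negbTE at_); under eq_bigr do rewrite mul1r.
by rewrite sum_dbspline// mul0r.
Qed.

(** The key to the maximum principle. The basis functions with a time index
    smaller than that of i add up to a function of time alone, so advection and
    diffusion do not see their sum, and this function decreases on the support
    of the i-th basis function. So the corresponding entries of row i of the
    Galerkin matrix have a negative sum. *)
Lemma Kmat_upwind i : (0 < i t)%N ->
  exists2 j, j \in Sh i & (j t < i t)%N /\ K i j < 0.
Proof.
move=> it; have itm := ltn_ord (i t).
pose c : cval R m p := [ffun j : cidx m p => (j t < i t)%N%:R].
pose w := p%:R / (knot (L t) (m t) p (i t + p) - knot (L t) (m t) p (i t)).
have w0 : 0 < w.
  rewrite divr_gt0 ?ltr0n// subr_gt0; apply: knot_lt => //; lia.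
pose F z := w * bspline (L t) (m t) p p.-1 (i t) (z 0 t) * tbasis L i z.
have bF : bm F.
  apply: bounded_measurableM; last by rewrite -spline_unit; exact: bm_spline.
  apply: bounded_measurableM; first exact: bounded_measurable_cst.
  apply: (bounded_measurable_coord (h := bspline (L t) (m t) p p.-1 (i t))).
    exact: measurable_bspline.
  exact: bounded_bspline.
have F0 : 0 < box_integral L F.
  (* the first nonempty knot interval in the support of the i-th B-spline; in
     time it is also one for degree p - 1, as i t > 0 *)
  pose l b := maxn (i b) p.
  have hl b : nonempty_cell (m b) p (l b).
    by rewrite /nonempty_cell /l; have := ltn_ord (i b); have := hm b; lia.
  apply: (@box_integral_gt0 _ _ _ _ (fun b => knot (L b) (m b) p (l b))
    (fun b => knot (L b) (m b) p (l b).+1)) => //.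
  - move=> z zb; have zb' b : 0 <= z 0 b <= L b.
      by have /andP[/ltW-> /ltW->] := zb b.
    apply: mulr_ge0; first by rewrite mulr_ge0 ?(ltW w0) ?bspline_ge0.
    by rewrite /tbasis; apply: prodr_ge0 => b _; exact: bspline_ge0.
  - by move=> b; exact: knot_cell.
  - move=> z zl; split; first by move=> b; exact: in_cell_box (zl b).
    apply: mulr_gt0.
      rewrite mulr_gt0//.
      by apply: (bspline_gt0 (hL t) (hm t) (hl t) (zl t)); rewrite /l; lia.
    rewrite /tbasis; apply: prodr_gt0 => b _.
    by apply: (bspline_gt0 (hL b) (hm b) (hl b) (zl b)); rewrite /l; lia.
have sumK : \sum_j c j * K i j = - box_integral L F.
  rewrite sum_Kmat /spline_galerkin spline_unit -mulN1r -box_integralZ//.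
  have dc0 k z : open_box L z -> off z -> dspline L (sp k) c z = 0.
    move=> zb zk; have [l lz] := off_grid_cells hm hL zb zk.
    rewrite (dspline_time_lt _ lz) ?(ltnW itm)//.
    by rewrite eq_sym (negbTE (neq_lift _ _)).
  rewrite ![\sum_(k < d) _]big1 ?mulr0 ?addr0.
  - apply: eq_box_integral_grid => z zb zk; have [l lz] := off_grid_cells hm hL zb zk.
    by rewrite (dspline_time_lt _ lz) ?(ltnW itm)// eqxx /F /w; ring.
  - by move=> k _; apply: box_integral_grid0 => z zb zk; rewrite dc0 ?mul0r.
  - by move=> k _; apply: box_integral_grid0 => z zb zk; rewrite dc0 ?mul0r.
have : \sum_j c j * K i j < 0 by rewrite sumK oppr_lt0.
have [/existsP[j /andP[jt Kneg]] _|/existsPn noj] :=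
    boolP [exists j : cidx m p, (j t < i t)%N && (K i j < 0)].
  exists j => //; apply: contraTT Kneg => /Kmat_sparse ->.
  by rewrite ltxx.
rewrite ltNge => /negP[]; apply: sumr_ge0 => j _; rewrite ffunE.
case jt : (j t < i t)%N; last by rewrite mul0r.
by rewrite mul1r leNgt; have := noj j; rewrite jt.
Qed.

End galerkin.

(** * Coefficients fixed by the boundary and initial conditions *)

Section constrained.
Variables (R : realType) (d p : nat) (m : 'I_d.+1 -> nat) (L : 'I_d.+1 -> R).
Variables (mu : R) (beta : 'rV[R]_d -> 'rV[R]_d).
Hypotheses (hm : forall a, (0 < m a)%N) (hL : forall a, 0 < L a) (hp : (0 < p)%N).
Hypothesis hbeta : velocity_C1 L beta.
Implicit Types (i j : cidx m p) (u v : cval R m p) (z : 'rV[R]_d.+1) (a b : 'I_d.+1).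
Notation t := (ord_max : 'I_d.+1).
Notation sp := (@space_dir d).

Lemma st_point_time (x : 'rV[R]_d) (s : R) : st_point x s 0 t = s.
Proof. by rewrite mxE unlift_none. Qed.

Lemma st_point_space (x : 'rV[R]_d) (s : R) k : st_point x s 0 (sp k) = x 0 k.
Proof. by rewrite mxE /space_dir liftK. Qed.

Lemma st_point_parts z : st_point (space_part z) (z 0 t) = z.
Proof.
apply/rowP => a; rewrite mxE; case: unliftP => [k|] ->; last by [].
by rewrite mxE.
Qed.

(** A condition at x on the velocity through one face holds on this face around
    x, so a nonempty inflow boundary contains an open piece of a face. *)
Lemma Gamma_D_near x : Gamma_D L mu beta x -> exists (k : 'I_d) (e : R), [/\ 0 < e,
  x 0 k = 0 \/ x 0 k = L_space L k &
  forall y, closed_box (L_space L) y -> y 0 k = x 0 k ->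
    (forall l, `|y 0 l - x 0 l| < e) -> Gamma_D L mu beta y].
Proof.
move=> [xb [k hk]]; exists k.
have near_sign (P : set R) : (\forall r \near beta x 0 k, P r) ->
    exists2 e : R, 0 < e & forall y : 'rV[R]_d, (forall l, `|y 0 l - x 0 l| < e) -> P (beta y 0 k).
  move=> nP; have := velocity_continuous hbeta xb nP.
  move=> /nbhs_ballP[e /= e0 eP]; exists e => // y xy; apply: eP; split => // r l.
  by rewrite ord1 /ball /= distrC.
have [e e0 eP] : exists2 e : R, 0 < e & forall y : 'rV[R]_d, y 0 k = x 0 k ->
    (forall l, `|y 0 l - x 0 l| < e) ->
    (y 0 k = 0 /\ (0 < mu \/ - beta y 0 k < 0)) \/
    (y 0 k = L_space L k /\ (0 < mu \/ beta y 0 k < 0)).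
  case: hk => -[xk [mu0|bk]].
  - by exists 1 => // y -> _; left; split => //; left.
  - rewrite oppr_lt0 in bk; have [e e0 eP] := near_sign [set r | 0 < r] (lt_nbhsr bk).
    by exists e => // y -> /eP yk; left; split => //; right; rewrite oppr_lt0.
  - by exists 1 => // y -> _; right; split => //; left.
  - have [e e0 eP] := near_sign [set r | r < 0] (lt_nbhsl bk).
    by exists e => // y -> /eP yk; right; split => //; right.
exists e; split => //; first by case: hk => -[? _]; [left|right].
by move=> y yb yk ye; split => //; exists k; exact: eP.
Qed.

(** In the direction across the face of Gamma_D that meets the support, the
    end point of the interval determines the coefficient; in the other directions
    and in time, small intervals do, on which the point stays in Gamma_D. *)
Lemma boundary_coef_eq u v i :
  (forall x s, Gamma_D L mu beta x -> 0 < s <= T_end L ->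
     spline L u (st_point x s) = spline L v (st_point x s)) ->
  (exists x s, [/\ Gamma_D L mu beta x, 0 < s <= T_end L &
     tbasis L i (st_point x s) != 0]) ->
  u i = v i.
Proof.
move=> uv [x [s [xG /andP[s0 sT] nz]]].
have [k [e [e0 xk eG]]] := Gamma_D_near xG; have [xb _] := xG.
set z := st_point x s in nz *.
have zb a : 0 <= z 0 a <= L a.
  rewrite /z mxE; case: unliftP => [l ->|->]; first exact: xb l.
  by rewrite (ltW s0) sT.
have zk : z 0 (sp k) = x 0 k by rewrite st_point_space.
have nza a : bspline (L a) (m a) p p (i a) (z 0 a) != 0.
  by move/prodf_neq0 : nz => /(_ a); exact.
have hS a : exists S : set R, [/\ separates (L a) S (i a),
    forall y, S y -> 0 <= y <= L a /\ `|y - z 0 a| < e,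
    a = sp k -> forall y, S y -> y = x 0 k &
    a = t -> forall y, S y -> 0 < y].
  have [ak|ak] := eqVneq a (sp k).
    exists [set x 0 k]; split => //.
    - rewrite ak; have := nza (sp k); rewrite zk; case: xk => ->.
        rewrite bspline_at0// subnn pnatr_eq0 eqb0 negbK => /eqP.
        exact: separates_at0.
      rewrite bspline_atL// pnatr_eq0 eqb0 negbK => /eqP.
      exact: separates_atL.
    - by move=> y /= ->; rewrite ak -zk subrr normr0.
    - by move=> kt; have := neq_lift t k; rewrite -[lift t k]/(sp k) -ak kt eqxx.
  have [b [c [b0 bc cL near_z sep]]] := separates_near (hL a) (hm a) hp e0 (zb a) (nza a).
  exists [set y | b < y < c]; split => //.
  - move=> y /= hy; split; last exact: near_z.
    by have /andP[h1 h2] := hy; rewrite (ltW (le_lt_trans b0 h1)) (ltW (lt_le_trans h2 cL)).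
  - by move=> /eqP; rewrite (negbTE ak).
  - by move=> _ y /= /andP[h1 _]; exact: le_lt_trans h1.
pose S a := projT1 (cid (hS a)).
have SP a : [/\ separates (L a) (S a) (i a),
    forall y, S a y -> 0 <= y <= L a /\ `|y - z 0 a| < e,
    a = sp k -> forall y, S a y -> y = x 0 k &
    a = t -> forall y, S a y -> 0 < y] by rewrite /S; case: cid.
suff : [ffun j => u j - v j] i = 0 :> R by rewrite ffunE => /eqP; rewrite subr_eq0 => /eqP.
apply: (@spline_coef_eq0 _ _ _ _ L i _ S) => [a|z' Sz']; first by have [] := SP a.
rewrite splineB -(st_point_parts z') uv ?subrr//.
  apply: eG.
  - by move=> l; rewrite mxE; have [_ /(_ _ (Sz' _))[] ] := SP (sp l).
  - by rewrite mxE; have [_ _ /(_ erefl _ (Sz' _))] := SP (sp k).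
  - move=> l; rewrite mxE; have [_ /(_ _ (Sz' _))[_] ] := SP (sp l).
    by rewrite /z st_point_space.
have [_ /(_ _ (Sz' _))[/andP[_ h] _] _ /(_ erefl _ (Sz' _)) h'] := SP t.
by rewrite h' h.
Qed.

Definition space_idx i : cidx (m_space m) p := [ffun k => i (sp k)].

Let initial_idx_nat (i : cidx (m_space m) p) a : nat :=
  if unlift t a is Some k then i k else 0%N.

Let initial_idx_bound (i : cidx (m_space m) p) a : (initial_idx_nat i a < m a + p)%N.
Proof.
rewrite /initial_idx_nat; case: unliftP => [k ->|->]; first exact: ltn_ord.
by have := hm t; lia.
Qed.

Definition initial_idx (i : cidx (m_space m) p) : cidx m p :=
  [ffun a => Ordinal (initial_idx_bound i a)].

Lemma initial_idxK : cancel initial_idx space_idx.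
Proof.
move=> i; apply/ffunP => k; rewrite !ffunE; apply/val_inj => /=.
by rewrite /initial_idx_nat /space_dir liftK.
Qed.

Lemma initial_idx_time (k : cidx (m_space m) p) : initial_idx k t = 0%N :> nat.
Proof. by rewrite ffunE /= /initial_idx_nat unlift_none. Qed.

Lemma space_idxK i : i t = 0%N :> nat -> initial_idx (space_idx i) = i.
Proof.
move=> it; apply/ffunP => a; rewrite ffunE; apply/val_inj => /=.
rewrite /initial_idx_nat; case: (unliftP t a) => [k ->|->] //.
by rewrite ffunE.
Qed.

Lemma tbasis_initial i x :
  tbasis L i (st_point x 0) = (i t == 0%N :> nat)%:R * tbasis (L_space L) (space_idx i) x.
Proof.
rewrite /tbasis (bigD1_ord t)//= st_point_time bspline_at0// subnn; congr (_ * _).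
by apply: eq_bigr => k _; rewrite ffunE -[lift t k]/(sp k) st_point_space.
Qed.

(** At t = 0 only the basis functions with time index 0 are left, and there they
    are the spatial ones; so u0 can be compared with u as a space--time spline. *)
Lemma spline_initial (u0 : cval R (m_space m) p) x :
  spline L [ffun i => u0 (space_idx i)] (st_point x 0) = spline (L_space L) u0 x.
Proof.
rewrite /spline; under eq_bigr do rewrite ffunE tbasis_initial.
rewrite (bigID (fun i => i t == 0%N :> nat)) /= [X in _ + X]big1 ?addr0; last first.
  by move=> i /negbTE ->; rewrite mul0r mulr0.
rewrite (reindex_onto initial_idx space_idx) => [|i /eqP]; last exact: space_idxK.
apply: eq_big => [i'|i' _]; first by rewrite initial_idx_time initial_idxK !eqxx.
by rewrite initial_idx_time initial_idxK mul1r.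
Qed.

Lemma initial_coef_eq u (u0 : cval R (m_space m) p) i :
  (forall x, open_box (L_space L) x ->
     spline L u (st_point x 0) = spline (L_space L) u0 x) ->
  i t = 0%N :> nat -> u i = u0 (space_idx i).
Proof.
move=> uu0 it; pose w : cval R m p := [ffun i => u0 (space_idx i)].
suff : [ffun j => u j - w j] i = 0 :> R.
  by rewrite !ffunE => /eqP; rewrite subr_eq0 => /eqP.
pose l a := maxn (i a) p.
have hl a : nonempty_cell (m a) p (l a).
  by rewrite /nonempty_cell /l; have := ltn_ord (i a); have := hm a; lia.
pose S a : set R := if a == t then [set 0] else [set x | in_cell (L a) (m a) p (l a) x].
apply: (@spline_coef_eq0 _ _ _ _ L i _ S) => [a|z Sz].
  rewrite /S; case: eqVneq => [->|_]; first exact: separates_at0.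
  apply: (separates_itv (hL a) (hm a) (hl a)) => //; first by rewrite /l; lia.
  exact: knot_cell.
have zt : z 0 t = 0 by have := Sz t; rewrite /S eqxx.
rewrite splineB -(st_point_parts z) zt spline_initial uu0 ?subrr// => k.
have := Sz (sp k); rewrite /S eq_sym (negbTE (neq_lift _ _)) mxE.
exact: in_cell_box.
Qed.

Lemma Vh0_unit i : (0 < i t)%N ->
  ~ (exists x s, [/\ Gamma_D L mu beta x, 0 < s <= T_end L &
       tbasis L i (st_point x s) != 0]) -> Vh0 L mu beta (unit_cval R i).
Proof.
move=> it nz; split => [x s xG sT|x xb]; rewrite spline_unit.
  by apply/eqP; apply: contra_notT nz => nz; exists x, s.
by rewrite tbasis_initial (gtn_eqF it) mul0r.
Qed.

End constrained.

(** * The discrete maximum principle *)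

Section stabilization.
Variables (R : realType) (d p : nat) (m : 'I_d.+1 -> nat) (L : 'I_d.+1 -> R).
Variables (mu q : R) (beta : 'rV[R]_d -> 'rV[R]_d) (sd : sym_data R m p).
Implicit Types (i j k : cidx m p) (u v w : cval R m p).
Notation K := (Kmat L mu beta).
Notation Kt := (Ktilde L mu beta q sd).
Notation nu := (nu L mu beta q sd).

Lemma BmatE w i j : Bmat L mu beta q sd w i j =
  if j \in Sh i then nu w i j * ell R i j else 0.
Proof.
rewrite /Bmat /Bh (bigD1 i)//= [X in _ + X]big1 ?addr0; last first.
  by move=> k ki; rewrite big1// => l _; rewrite ffunE (negbTE ki) mulr0 !mul0r.
rewrite big_mkcond (bigD1 j)//= [X in _ + X]big1 ?addr0; last first.
  by move=> k kj; rewrite [X in _ * X * _]ffunE (negbTE kj) mulr0 mul0r; case: ifP.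
by rewrite !ffunE !eqxx !mulr1.
Qed.

Lemma Bh_unit w u i : Bh L mu beta q sd w u (unit_cval R i) =
  \sum_j Bmat L mu beta q sd w i j * u j.
Proof.
rewrite /Bh (bigD1 i)//= [X in _ + X]big1 ?addr0; last first.
  by move=> k ki; rewrite big1// => l _; rewrite ffunE (negbTE ki) mulr0 !mul0r.
rewrite big_mkcond; apply: eq_bigr => j _; rewrite BmatE.
by case: ifP; rewrite ?mul0r// ffunE eqxx mulr1 mulrAC.
Qed.

Lemma Ktilde_le w i j : j != i -> Kt w i j <= K i j.
Proof.
move=> ji; rewrite /Ktilde gerDl BmatE; case: ifP => // _.
rewrite /Defs.nu (negbTE ji) /ell eq_sym (negbTE ji) mulr0 sub0r mulrN1 oppr_le0.
by rewrite /nu_off !le_max lexx orbT.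
Qed.

End stabilization.

(** All terms of the sum have the same sign, so each of them vanishes. With the
    distances v of the control values from an extremal one, this hands the
    extremal value on along the negative entries of the row. *)
Lemma extremal_row_eq (R : realDomainType) (I : finType) (S : {pred I})
    (A v : I -> R) (i : I) :
  (forall j, j \in S -> j != i -> A j <= 0) -> v i = 0 -> (forall j, 0 <= v j) ->
  \sum_(j in S) A j * v j = 0 ->
  forall j, j \in S -> A j < 0 -> v j = 0.
Proof.
move=> A0 vi v0 Av j jS Aj.
have : \sum_(j in S) - (A j * v j) == 0 by rewrite sumrN Av oppr0.
rewrite psumr_eq0 => [/allP/(_ j)|k kS].
  rewrite mem_index_enum jS implyTb => /(_ isT).
  by rewrite oppr_eq0 mulf_eq0 (lt_eqF Aj) => /eqP.
have [->|ki] := eqVneq k i; first by rewrite vi mulr0 oppr0.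
by rewrite oppr_ge0 mulr_le0_ge0// A0.
Qed.

Section maximum_principle.
Variables (R : realType) (d p : nat) (m : 'I_d.+1 -> nat) (L : 'I_d.+1 -> R).
Variables (mu q : R) (beta : 'rV[R]_d -> 'rV[R]_d) (sd : sym_data R m p).
Hypotheses (hm : forall a, (0 < m a)%N) (hL : forall a, 0 < L a) (hp : (0 < p)%N).
Hypothesis hbeta : velocity_C1 L beta.
Variables (g : 'rV[R]_d.+1 -> R) (ubar : cval R m p) (u0 : cval R (m_space m) p).
Variable u : cval R m p.
Hypothesis hdata : data_dmp L mu beta ubar u0.
Hypothesis hsol : is_solution L mu beta q sd g ubar u0 u.
Hypothesis hg : forall z, open_box L z -> g z = 0.
Implicit Types (i j : cidx m p).
Notation t := (ord_max : 'I_d.+1).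
Notation Kt := (Ktilde L mu beta q sd u).
Hypothesis hK : forall i, local_min u i \/ local_max u i ->
  (forall j, j \in Sh i :\ i -> Kt i j <= 0) /\ \sum_(j in Sh i) Kt i j = 0.

Lemma solution_row i : Vh0 L mu beta (unit_cval R i) ->
  \sum_(j in Sh i) Kt i j * u j = 0.
Proof.
case: hsol => _ _ /[apply].
rewrite [RHS]/inner box_integral0 => [|z zb]; last by rewrite hg// mul0r.
rewrite galerkin_spline// -sum_Kmat// Bh_unit -big_split /= => row0.
rewrite -[RHS]row0 big_mkcond; apply: eq_bigr => j _; case: ifPn => jS.
  by rewrite /Ktilde mulrDl mulrC.
by rewrite (Kmat_sparse mu hm hL hp hbeta jS) BmatE (negbTE jS) mulr0 mul0r addr0.
Qed.

Lemma constrained_in_range i : i t = 0%N :> nat \/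
  (exists x s, [/\ Gamma_D L mu beta x, 0 < s <= T_end L &
       tbasis L i (st_point x s) != 0]) -> in_data_range L mu beta ubar u0 (u i).
Proof.
have [uG uI _] := hsol; have [dG dI] := hdata; case => [it|ix].
  by rewrite (initial_coef_eq hm hL hp uI it).
by rewrite (boundary_coef_eq hm hL hp hbeta uG ix); exact: dG.
Qed.

(** Descent in time: at an extremal index that is not constrained by the data,
    the negative entry of an earlier index hands the extremal value on to this
    index. The sign e is 1 for a maximum and -1 for a minimum. *)
Lemma extremum_in_range (e : R) i : e = 1 \/ e = -1 ->
  (forall j, 0 <= e * (u i - u j)) -> in_data_range L mu beta ubar u0 (u i).
Proof.
move=> he; have [n] := ubnP (i t); elim: n i => // n IH i itn ext.
have [it0|it] := posnP (i t); first by apply: constrained_in_range; left.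
have [ix|nix] := pselect (exists x s, [/\ Gamma_D L mu beta x, 0 < s <= T_end L &
    tbasis L i (st_point x s) != 0]); first by apply: constrained_in_range; right.
have row := solution_row (Vh0_unit hm hL it nix).
have [|K0 Ksum] := @hK i.
  case: he => e1; [right|left] => j _; have := ext j; rewrite e1.
    by rewrite mul1r subr_ge0.
  by rewrite mulN1r opprB subr_ge0.
have [j jS [jt Kneg]] := Kmat_upwind mu hm hL hp hbeta it.
have ji : j != i by apply: contraTneq jt => ->; rewrite ltnn.
have uji : e * (u i - u j) = 0.
  apply: (@extremal_row_eq _ _ (mem (Sh i)) (Kt i) (fun j => e * (u i - u j)) i) => //.
  - by move=> k kS ki; apply: K0; rewrite !inE ki; rewrite inE in kS.
  - by rewrite subrr mulr0.
  - under eq_bigr do rewrite mulrCA mulrBr.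
    by rewrite -mulr_sumr sumrB -mulr_suml Ksum row mul0r subrr mulr0.
  - by rewrite (le_lt_trans (Ktilde_le _ _ _ _ _ _ _)).
have uij : u i = u j.
  by case: he uji => ->; rewrite ?mul1r ?mulN1r ?opprB => /eqP; rewrite subr_eq0 => /eqP.
rewrite uij; apply: IH; first by rewrite (leq_trans jt).
by move=> k; rewrite -uij.
Qed.

Lemma discrete_maximum_principle i : in_data_range L mu beta ubar u0 (u i).
Proof.
have [imax _ hmax] := arg_maxP (fun j => u j) (isT : xpredT i).
have [imin _ hmin] := arg_minP (fun j => u j) (isT : xpredT i).
have /andP[_ h1] : in_data_range L mu beta ubar u0 (u imax).
  apply: (@extremum_in_range 1); first by left.
  by move=> j; rewrite mul1r subr_ge0; exact: hmax.
have /andP[h2 _] : in_data_range L mu beta ubar u0 (u imin).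
  apply: (@extremum_in_range (-1)); first by right.
  by move=> j; rewrite mulN1r opprB subr_ge0; exact: hmin.
apply/andP; split.
  by apply: (le_trans h2); rewrite lee_fin; exact: hmin.
by apply: le_trans h1; rewrite lee_fin; exact: hmax.
Qed.

End maximum_principle.

(** * Convex hulls of Greville points *)

Section convex_hulls.
Variables (R : realType) (n : nat).
Implicit Types (S : set 'rV[R]_n) (x y z : 'rV[R]_n) (a : 'I_n).

Lemma sub_conv_hull S x : S x -> conv_hull S x.
Proof. by move=> Sx A [_]; apply. Qed.

Lemma conv_hull_segment S x y (s : R) : 0 <= s <= 1 ->
  conv_hull S x -> conv_hull S y -> conv_hull S ((1 - s) *: x + s *: y).
Proof.
move=> /andP[s0 s1] hx hy A /= [cA SA].
have xA : x \in A by rewrite inE; exact: hx.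
have yA : y \in A by rewrite inE; exact: hy.
have := cA _ _ (Itv01 s0 s1) yA xA; rewrite inE.
by rewrite /conv /= addrC.
Qed.

Lemma conv_hull_halfspace S a (e c : R) : (forall x, S x -> e * x 0 a <= c) ->
  forall x, conv_hull S x -> e * x 0 a <= c.
Proof.
move=> Sc x hx; apply: (hx [set x | e * x 0 a <= c]); split => [y z s|]; last exact: Sc.
rewrite !inE /= => yc zc.
rewrite -[conv _ _ _]/(s%:num *: (y : 'rV[R]_n) + (1 - s%:num) *: z) !mxE.
have s0 : 0 <= s%:num by [].
have s1 : s%:num <= 1 by [].
have := ler_wpM2l s0 yc; have := ler_wpM2l (_ : 0 <= 1 - s%:num) zc.
rewrite subr_ge0 => /(_ s1) h1 h2.
move: (s%:num) h1 h2 => r h1 h2.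
rewrite (_ : e * _ = r * (e * y 0 a) + (1 - r) * (e * z 0 a)); last by ring.
by rewrite (le_trans (lerD h2 h1))//; lra.
Qed.

(** The coordinates are released one after the other, each along a segment. *)
Lemma conv_hull_box S x y :
  (forall w : 'rV[R]_n, (forall a, w 0 a = x 0 a \/ w 0 a = y 0 a) -> conv_hull S w) ->
  forall z : 'rV[R]_n, (forall a, exists2 s, 0 <= s <= 1 & z 0 a = (1 - s) * x 0 a + s * y 0 a) ->
  conv_hull S z.
Proof.
move=> corner.
have step (r : seq 'I_n) : forall z : 'rV[R]_n,
    (forall a, a \in r -> exists2 s, 0 <= s <= 1 & z 0 a = (1 - s) * x 0 a + s * y 0 a) ->
    (forall a, a \notin r -> z 0 a = x 0 a \/ z 0 a = y 0 a) -> conv_hull S z.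
  elim: r => [|b r IH] z hr hn.
    by apply: corner => a; exact: hn.
  have [s s01 zb] := hr b (mem_head _ _).
  pose w v : 'rV[R]_n := \row_a (if a == b then v else z 0 a).
  have -> : z = (1 - s) *: w (x 0 b) + s *: w (y 0 b).
    apply/rowP => a; rewrite !mxE; case: eqVneq => [->|_]; first exact: zb.
    by ring.
  have hw v : v = x 0 b \/ v = y 0 b -> conv_hull S (w v).
    move=> vb; apply: IH => a; rewrite mxE; case: eqVneq => [->|ab] ar.
    - case: vb => ->; first by exists 0; rewrite ?lexx ?ler01//; ring.
      by exists 1; rewrite ?lexx ?ler01//; ring.
    - by apply: hr; rewrite inE ar orbT.
    - exact: vb.
    - by apply: hn; rewrite inE negb_or ab.
  by apply: conv_hull_segment => //; apply: hw; [left|right].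
move=> z hz; apply: (step (enum 'I_n)) => // a; by rewrite mem_enum.
Qed.

End convex_hulls.

(** * Linearity preservation *)

Lemma dot_comb (R : realType) n (I : finType) (P : pred I) (w : I -> R)
    (b : 'rV[R]_n) (x : I -> 'rV[R]_n) :
  dot b (\sum_(i | P i) w i *: x i) = \sum_(i | P i) w i * dot b (x i).
Proof.
rewrite /dot; under [RHS]eq_bigr do rewrite mulr_sumr.
rewrite [RHS]exchange_big; apply: eq_bigr => a _; rewrite summxE mulr_sumr.
by apply: eq_bigr => i _; rewrite mxE mulrCA.
Qed.

Section linearity.
Variables (R : realType) (d p : nat) (m : 'I_d.+1 -> nat) (L : 'I_d.+1 -> R).
Hypotheses (hm : forall a, (0 < m a)%N) (hL : forall a, 0 < L a) (hp : (0 < p)%N).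
Implicit Types (i j k : cidx m p) (u : cval R m p) (y z : 'rV[R]_d.+1) (a : 'I_d.+1).
Notation xg := (gpoint L).

(** A neighbour of i differs from i by one step in some direction, and no other
    neighbour is farther away in this direction. *)
Lemma neighbour_extreme i j : j \in Nh i :\ i -> exists (a : 'I_d.+1) (e : R),
  e * xg i 0 a < e * xg j 0 a /\
  (forall k, k \in Nh i -> e * xg k 0 a <= e * xg j 0 a).
Proof.
rewrite !inE => /andP[ji /forallP near].
have [a ija] : exists a, i a != j a.
  apply/existsP; apply: contraNT ji => /existsPn h; apply/eqP/ffunP => a.
  by have := h a; rewrite negbK => /eqP.
have ija' : (i a != j a :> nat) by [].
have [h1 h2] := andP (near a); exists a.
have ia := ltn_ord (i a); have ja := ltn_ord (j a).
case: (ltngtP (i a) (j a)) ija' => // lt _.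
  exists 1; split => [|k]; rewrite !mul1r !mxE.
    by apply: greville_lt => //; lia.
  rewrite inE => /forallP/(_ a)/andP[_ h3].
  by apply: greville_le => //; lia.
exists (-1); split => [|k]; rewrite !mulN1r ?lerN2 ?ltrN2 !mxE.
  by apply: greville_lt => //; lia.
rewrite inE => /forallP/(_ a)/andP[h3 _].
by apply: greville_le => //; lia.
Qed.

(** The second boundary point on the line through an interior x_i and x_j lies
    beyond x_i: the points strictly between x_i and x_j, and x_i itself, are
    interior, and x_j maximizes a coordinate or its opposite on the hull, which
    is larger at the points beyond x_j. *)
Lemma xsym_beyond i j y : interior_cp L i -> j \in Nh i :\ i -> is_xsym L i j y ->
  exists2 s, s < 0 & on_line L i j y s.
Proof.
move=> iint jN [[ycl yint] yj [s ys]]; exists s => //; rewrite ltNge; apply/negP => s0.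
have [a [e [eij emax]]] := neighbour_extreme jN.
have Qe z : Qset L i z -> e * z 0 a <= e * xg j 0 a.
  apply: conv_hull_halfspace => _ /= [k kN <-]; apply: emax.
  by move: kN; rewrite !inE => /andP[].
have [s1|s1|s1] := ltgtP s 1; last first.
- by move: yj; rewrite ys s1 scale1r addrC subrK eqxx.
- have jy : e * xg j 0 a < e * y 0 a.
    rewrite ys !mxE; rewrite !mxE in eij; rewrite -subr_gt0.
    rewrite (_ : _ - _ = (s - 1) * (e * greville (L a) (m a) p (j a)
      - e * greville (L a) (m a) p (i a))); last by ring.
    by rewrite mulr_gt0 ?subr_gt0.
  have cont : {for y, continuous (fun w : 'rV[R]_d.+1 => e * w 0 a)}.
    apply: (@continuous_comp _ _ _ (fun w : 'rV[R]_d.+1 => w 0 a) ( *%R e)).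
      exact: coord_continuous.
    exact: mulrl_continuous.
  have [w /= [/Qe Qw]] := ycl _ (cont [set r | e * xg j 0 a < r] (lt_nbhsr jy)).
  by rewrite ltNge Qw.
apply: yint; have /nbhs_ballP[r /= r0 rQ] := iint.
have s1' : 0 < 1 - s by rewrite subr_gt0.
apply/nbhs_ballP; exists ((1 - s) * r); first by rewrite /= mulr_gt0.
move=> w [_ yw].
have -> : w = (1 - s) *: (xg i + (1 - s)^-1 *: (w - y)) + s *: xg j.
  rewrite scalerDr scalerA mulfV ?gt_eqF// scale1r ys /on_line.
  by rewrite scalerBl scalerBr scale1r; apply/rowP => b; rewrite !mxE; ring.
apply: conv_hull_segment; first by rewrite s0 ltW.
  apply: rQ; split => // k b; have := yw k b; rewrite ord1 /ball /= !mxE => ywb.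
  rewrite opprD addrA subrr sub0r normrN normrM normfV (gtr0_norm s1').
  by rewrite ltr_pdivrMl// distrC.
by apply: sub_conv_hull; exists j.
Qed.

(** The points of the grid at distance at most p + 1 from i are those that enter
    the detectors of the neighbours in the stencil of i. *)
Lemma stencil_neighbours i j : Defs.within p.+1 i j ->
  exists2 k, k \in Sh i & j \in Nh k.
Proof.
move=> /forallP near.
(* one step from j towards i *)
pose kn a : nat := if (j a < i a)%N then minn (j a).+1 (i a) else maxn (j a).-1 (i a).
have kb a : (kn a < m a + p)%N.
  by rewrite /kn; have := ltn_ord (i a); have := ltn_ord (j a); case: ifP; lia.
exists [ffun a => Ordinal (kb a)]; rewrite inE; apply/forallP => a; rewrite ffunE /= /kn;
  by have := near a; case: ifP; lia.
Qed.

Lemma stencil_neighbours_within i j k : k \in Sh i -> j \in Nh k -> Defs.within p.+1 i j.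
Proof.
rewrite !inE => /forallP h1 /forallP h2; apply/forallP => a.
by have := h1 a; have := h2 a; lia.
Qed.

(** The affine function has the Greville values as coefficients, and around each
    Greville point of the stencil the coefficients are determined by the values
    of the spline on a box that is spanned by Greville points. *)
Lemma affine_coef u i c b : (forall x, Omega_i L i x -> spline L u x = c + dot b x) ->
  forall j, Defs.within p.+1 i j -> u j = c + dot b (xg j).
Proof.
move=> uaff j ij; have /forallP near := ij.
(* in each direction a neighbour of j that is not farther from i than p + 1 *)
pose nn a : nat := if (i a <= j a)%N && (0 < j a)%N then (j a).-1 else (j a).+1.
have nb a : (nn a < m a + p)%N.
  rewrite /nn; have := ltn_ord (i a); have := ltn_ord (j a); have := hm a.
  by case: ifP; lia.
pose n a : 'I_(m a + p) := Ordinal (nb a).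
have hn a : n a = (j a).+1 :> nat \/ j a = (n a).+1 :> nat.
  by rewrite /n /nn /=; case: ifP; lia.
have near_n a : (i a <= n a + p.+1)%N && (n a <= i a + p.+1)%N.
  by have := near a; rewrite /n /nn /=; case: ifP; lia.
pose good a (S : set R) := [/\ separates (L a) S (j a),
  exists2 l, nonempty_cell (m a) p l & forall x, S x -> in_cell (L a) (m a) p l x &
  forall x, S x -> exists2 s, 0 <= s <= 1 &
    x = (1 - s) * greville (L a) (m a) p (j a) + s * greville (L a) (m a) p (n a)].
have hS a : exists S, good a S.
  have [x [y [xy [l hl [lx yl]] sep seg]]] := separates_greville (hL a) (hm a) hp (hn a).
  exists [set r | x < r < y]; split => //; exists l => // r /andP[xr ry].
  by rewrite /in_cell (le_lt_trans lx xr) (lt_le_trans ry yl).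
pose S a := projT1 (cid (hS a)).
have SP a : good a (S a) by rewrite /S; case: cid.
pose w : cval R m p := [ffun k => c + dot b (xg k)].
suff : [ffun k => u k - w k] j = 0 :> R.
  by rewrite !ffunE => /eqP; rewrite subr_eq0 => /eqP.
apply: (@spline_coef_eq0 _ _ _ _ L j _ S) => [a|z Sz]; first by have [] := SP a.
have hl a : exists l, nonempty_cell (m a) p l /\ in_cell (L a) (m a) p l (z 0 a).
  by have [_ [l hl lS] _] := SP a; exists l; split => //; exact: lS.
have lz : in_cells m p L (fun a => projT1 (cid (hl a))) z by move=> a; case: cid.
rewrite splineB (spline_affine hm hL hp _ _ lz) uaff ?subrr//.
apply: (@conv_hull_box _ _ _ (xg j) (\row_a greville (L a) (m a) p (n a))) => [v hv|a].
  have hk a : exists k : 'I_(m a + p), v 0 a = greville (L a) (m a) p k /\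
      (i a <= k + p.+1)%N && (k <= i a + p.+1)%N.
    by case: (hv a) => ->; rewrite !mxE; [exists (j a)|exists (n a)].
  pose k : cidx m p := [ffun a => projT1 (cid (hk a))].
  have kP a : v 0 a = greville (L a) (m a) p (k a) /\
      (i a <= k a + p.+1)%N && (k a <= i a + p.+1)%N.
    by rewrite /k ffunE; case: cid.
  apply: sub_conv_hull; exists k => /=.
    by have [|k' ? ?] := @stencil_neighbours i k; [apply/forallP => a; have [] := kP a|exists k'].
  by apply/rowP => a; rewrite mxE; have [] := kP a.
have [_ _ /(_ _ (Sz a))[s s01 ->]] := SP a.
by exists s => //; rewrite !mxE.
Qed.

Lemma enorm_scale (s : R) y : enorm (s *: y) = `|s| * enorm y.
Proof.
rewrite /enorm (_ : dot _ _ = s ^+ 2 * dot y y).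
  by rewrite sqrtrM ?sqr_ge0// sqrtr_sqr.
by rewrite /dot mulr_sumr; apply: eq_bigr => a _; rewrite !mxE; ring.
Qed.

Variables (mu q : R) (beta : 'rV[R]_d -> 'rV[R]_d) (sd : sym_data R m p).
Hypothesis hq : 0 < q.
Hypothesis hsd : is_sym_data L sd.

(** A linear interpolation on a facet reproduces affine functions, it only uses
    control points around x_k, and it is taken beyond x_k (xsym_beyond). *)
Lemma sym_data_exact k : interior_cp L k -> exact_sym_data L sd k.
Proof.
move=> kint j jN; have [jsym [[c [b [_ supp]]] [w0 w1 wx]]] := hsd kint jN.
have off l : l \notin Nh k -> wsym sd k j l = 0.
  by apply: contraNeq => /supp[]; rewrite inE => /andP[].
split; first exact: xsym_beyond.
- by rewrite -[RHS]w1 big_mkcond; apply: eq_bigr => l _; case: ifPn => // /off ->.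
- rewrite -[RHS]wx big_mkcond; apply: eq_bigr => l _; case: ifPn => // /off ->.
  by rewrite scale0r.
Qed.

(** The two difference quotients in a jump are taken in opposite directions. *)
Lemma affine_Jump_eq0 u k c b : exact_sym_data L sd k ->
  (forall j, j \in Nh k -> u j = c + dot b (xg j)) ->
  forall j, j \in Nh k :\ k -> Jump L sd u k j = 0.
Proof.
move=> ex uaff j jN; have [[s s0 xs] w1 wx] := ex j jN.
have kN : k \in Nh k by rewrite inE; apply/forallP => a; rewrite leq_addr.
have jN' : j \in Nh k by move: jN; rewrite inE => /andP[].
have dotD (x y : 'rV[R]_d.+1) : dot b (x + y) = dot b x + dot b y.
  by rewrite /dot -big_split; apply: eq_bigr => a _; rewrite mxE mulrDr.
have dotZ (r : R) (x : 'rV[R]_d.+1) : dot b (r *: x) = r * dot b x.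
  by rewrite /dot mulr_sumr; apply: eq_bigr => a _; rewrite mxE mulrCA.
have us : usym sd u k j = c + dot b (xsym sd k j).
  rewrite /usym; under eq_bigr => l lN do rewrite uaff// mulrDr.
  by rewrite big_split -mulr_suml w1 mul1r -dot_comb wx.
rewrite /Jump us !uaff// xs /rnorm_sym xs /rnorm /on_line.
rewrite [xg k + _ - _]addrC addKr enorm_scale (ltr0_norm s0) dotD dotZ.
have -> : dot b (xg j) = dot b (xg k) + dot b (xg j - xg k) by rewrite -dotD addrC subrK.
set r := dot b (_ - _); set e := enorm _.
rewrite (_ : c + (dot b (xg k) + r) - _ = r); last by ring.
rewrite (_ : c + (dot b (xg k) + s * r) - _ = s * r); last by ring.
rewrite invfM mulrACA invrN mulrN divff ?lt_eqF//.
by rewrite mulN1r subrr.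
Qed.

Lemma linearity_preserving u i :
  (forall k, k \in Sh i -> ~ interior_cp L k -> exact_sym_data L sd k) ->
  affine_on (Omega_i L i) (spline L u) ->
  forall j, Bmat L mu beta q sd u i j = 0.
Proof.
move=> ex [c [b uaff]] j.
have alpha0 k : k \in Sh i -> alpha L sd q u k = 0.
  move=> kS; rewrite /alpha; case: ifP => // _.
  rewrite big1 => [|l lN]; first by rewrite normr0 mul0r powR0 ?gt_eqF.
  have exk : exact_sym_data L sd k.
    by have [kint|kint] := pselect (interior_cp L k); [exact: sym_data_exact|exact: ex].
  apply: affine_Jump_eq0 lN => // l' lN'; apply: affine_coef uaff _ _.
  exact: (stencil_neighbours_within kS lN').
have iS : i \in Sh i by rewrite inE; apply/forallP => a; rewrite leq_addr.
have nu0 k : k \in Sh i -> nu_off L mu beta q sd u i k = 0.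
  move=> kS; rewrite /nu_off (alpha0 _ iS) (alpha0 _ kS).
  move: (Kmat _ _ _ _ _) (Kmat _ _ _ _ _) => x y.
  by rewrite (mul0r x) (mul0r y) !maxxx.
rewrite BmatE; case: ifP => // jS; rewrite /nu; case: ifP => _.
  by rewrite big1 ?mul0r// => k; rewrite inE => /andP[_]; exact: nu0.
by rewrite nu0// mul0r.
Qed.

End linearity.

Theorem theorem3p1 (R : realType) (d p : nat) (m : 'I_d.+1 -> nat)
    (L : 'I_d.+1 -> R) (mu q : R) (beta : 'rV[R]_d -> 'rV[R]_d)
    (sd : sym_data R m p)
    (hd : (0 < d)%N) (hp : (0 < p)%N)
    (hm : forall a, (0 < m a)%N) (hL : forall a, 0 < L a)
    (hmu : 0 <= mu) (hq : 0 < q)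
    (hbeta : velocity_C1 L beta) (hdiv : divergence_free L beta)
    (hsd : is_sym_data L sd) :
  (forall (g : 'rV[R]_d.+1 -> R) (ubar : cval R m p)
      (u0 : cval R (m_space m) p) (u : cval R m p),
    data_dmp L mu beta ubar u0 ->
    is_solution L mu beta q sd g ubar u0 u ->
    (forall z, open_box L z -> g z = 0) ->
    (forall i, local_min u i \/ local_max u i ->
      (forall j, j \in Sh i :\ i -> Ktilde L mu beta q sd u i j <= 0) /\
      \sum_(j in Sh i) Ktilde L mu beta q sd u i j = 0) ->
    forall i, in_data_range L mu beta ubar u0 (u i))
  /\
  (forall (u : cval R m p) (i : cidx m p),
    (forall k, k \in Sh i -> ~ interior_cp L k -> exact_sym_data L sd k) ->
    affine_on (Omega_i L i) (spline L u) ->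
    forall j, Bmat L mu beta q sd u i j = 0).
Proof.
split.
  move=> g ubar u0 u hdata hsol hg hK.
  exact: discrete_maximum_principle hdata hsol hg hK.
by move=> u i; exact: linearity_preserving.
Qed.
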